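(* Let $\mathcal{M} \models \mathrm{KP}^\mathcal{P} + \Sigma_1^\mathcal{P}\text{-Separation}$ and $\mathcal{N} \models \mathrm{KP}^\mathcal{P} + \Sigma_1^\mathcal{P}\text{-Separation}$ be countable and non-standard. Let $\mathcal{S}$ be a common rank-cut of $\mathcal{M}$ and $\mathcal{N}$. Then the following are equivalent: (a) There is a rank-initial embedding $i : \mathcal{M} \rightarrow \mathcal{N}$ fixing $\mathcal{S}$ pointwise. (a') There is a rank-cut $i : \mathcal{M} \rightarrow \mathcal{N}$ (that is, a topless rank-initial embedding) fixing $\mathcal{S}$ pointwise. (b) $\mathrm{SSy}_\mathcal{S}(\mathcal{M}) = \mathrm{SSy}_\mathcal{S}(\mathcal{N})$, and $\mathrm{Th}_{\Sigma_1^\mathcal{P}, \mathcal{S}}(\mathcal{M}) \subseteq \mathrm{Th}_{\Sigma_1^\mathcal{P}, \mathcal{S}}(\mathcal{N})$.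
   Context: $\mathcal{L}^0$ is the first-order language of set theory, with the binary symbol $\in$. Takahashi hierarchy: $\Delta_0^\mathcal{P}=\Sigma_0^\mathcal{P}=\Pi_0^\mathcal{P}$ is the set of $\mathcal{L}^0$-formulae all of whose quantifiers are of the forms $\exists x\in y$, $\forall x\in y$, $\exists x\subseteq y$, $\forall x\subseteq y$; $\Sigma_{n+1}^\mathcal{P}$ consists of formulae $\exists x\,\phi$ with $\phi\in\Pi_n^\mathcal{P}$, and $\Pi_{n+1}^\mathcal{P}$ of formulae $\forall x\,\phi$ with $\phi\in\Sigma_n^\mathcal{P}$ (all up to provable equivalence in $\mathrm{KP}^\mathcal{P}$). $\mathrm{KP}^\mathcal{P}$ has the axioms Extensionality, Pair, Union, Powerset, Infinity, and the schemata (with parameters) $\Delta_0^\mathcal{P}$-Separation, $\Delta_0^\mathcal{P}$-Collection ($\forall x(\forall u\in x\,\exists v\,\phi(u,v)\to\exists y\,\forall u\in x\,\exists v\in y\,\phi(u,v))$), and $\Pi_1^\mathcal{P}$-Foundation ($\exists x\,\phi(x)\to\exists y(\phi(y)\wedge\forall v\in y\,\neg\phi(v))$). $\Gamma$-Separation is the Separation schema for formulae in $\Gamma$. A model is non-standard if its interpretation of $\in$ is not well-founded. $\mathrm{Ord}^\mathcal{N}$ is the class of ordinals of $\mathcal{N}$, and $\mathcal{N}_\alpha=\{n\in\mathcal{N}\mid\mathcal{N}\models\mathrm{rank}(n)<\alpha\}$. An embedding $i:\mathcal{M}\to\mathcal{N}$ is an injection with $\mathcal{M}\models x\in y\Leftrightarrow\mathcal{N}\models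 i(x)\in i(y)$. It is rank-initial if whenever $m\in\mathcal{M}$, $n\in\mathcal{N}$ and $\mathcal{N}\models\mathrm{rank}(n)\le\mathrm{rank}(i(m))$, then $n\in i(\mathcal{M})$. It is bounded if $i(\mathcal{M})\subseteq\mathcal{N}_\alpha$ for some $\alpha\in\mathrm{Ord}^\mathcal{N}$; it is topless if it is bounded and for every $\beta\in\mathrm{Ord}^\mathcal{N}\setminus i(\mathcal{M})$ there is $\beta'\in\mathrm{Ord}^\mathcal{N}\setminus i(\mathcal{M})$ with $\beta'<^\mathcal{N}\beta$. A rank-cut is a topless rank-initial embedding. These notions apply to a substructure via its inclusion map; a common rank-cut $\mathcal{S}$ of $\mathcal{M}$ and $\mathcal{N}$ is a common substructure that is rank-initial and topless in both. $\mathrm{SSy}_\mathcal{S}(\mathcal{M})$ is the structure $(\mathcal{S},\mathrm{Cod}_\mathcal{S}(\mathcal{M}))$, where $\mathrm{Cod}_\mathcal{S}(\mathcal{M})$ is the set of subsets of $\mathcal{S}$ of the form $\{x\in\mathcal{S}\mid\mathcal{M}\models x\in c\}$ with $c\in\mathcal{M}$. $\mathrm{Th}_{\Gamma,\mathcal{S}}(\mathcal{M})=\{\phi(\vec s)\mid\phi\in\Gamma,\ \vec s\in\mathcal{S},\ \mathcal{M}\models\phi(\vec s)\}$. *)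

(* Defs.v *)
From Stdlib Require List.
From mathcomp Require Import all_boot.
From mathcomp Require Import classical_sets cardinality.

Set Implicit Arguments.
Unset Strict Implicit.
Unset Printing Implicit Defensive.

Local Open Scope classical_set_scope.

(* Formulas of the language {∈, =}, with de Bruijn indices; there are no terms
   other than variables, so every substitution is a renaming. *)
Inductive formula : Type :=
| fBot
| fMem of nat & nat
| fEq of nat & nat
| fImp of formula & formula
| fAnd of formula & formula
| fOr of formula & formula
| fAll of formula
| fEx of formula.

Definition fNot (p : formula) := fImp p fBot.
Definition fIff (p q : formula) := fAnd (fImp p q) (fImp q p).

Definition scons (T : Type) (x : T) (s : nat -> T) (k : nat) : T :=
  if k is k'.+1 then s k' else x.

Fixpoint rename (r : nat -> nat) (p : formula) : formula :=
  match p with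
  | fBot => fBot
  | fMem i j => fMem (r i) (r j)
  | fEq i j => fEq (r i) (r j)
  | fImp p q => fImp (rename r p) (rename r q)
  | fAnd p q => fAnd (rename r p) (rename r q)
  | fOr p q => fOr (rename r p) (rename r q)
  | fAll p => fAll (rename (scons 0 (succn \o r)) p)
  | fEx p => fEx (rename (scons 0 (succn \o r)) p)
  end.

Definition shift (p : formula) := rename succn p.

(* [inst j p] replaces variable 0 by the variable j and lowers the others. *)
Definition inst (j : nat) (p : formula) := rename (scons j id) p.

(* The bounding variable [y] and [i], [j] are read outside the new quantifier,
   so it can never be the variable being bound. *)
Definition fSub (i j : nat) := fAll (fImp (fMem 0 i.+1) (fMem 0 j.+1)).
Definition fExIn (y : nat) (p : formula) := fEx (fAnd (fMem 0 y.+1) p).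
Definition fAllIn (y : nat) (p : formula) := fAll (fImp (fMem 0 y.+1) p).
Definition fExSub (y : nat) (p : formula) := fEx (fAnd (fSub 0 y.+1) p).
Definition fAllSub (y : nat) (p : formula) := fAll (fImp (fSub 0 y.+1) p).

(* Classical natural deduction from a theory [T].  The hypotheses in [G] are
   shifted by the quantifier rules, the members of [T] are not: a free variable
   of an axiom is thus implicitly universally quantified. *)
Inductive provable (T : set formula) : seq formula -> formula -> Prop :=
| prv_axiom G p : T p -> provable T G p
| prv_hyp G p : List.In p G -> provable T G p
| prv_contra G p : provable T (fNot p :: G) fBot -> provable T G p
| prv_impI G p q : provable T (p :: G) q -> provable T G (fImp p q)
| prv_impE G p q : provable T G (fImp p q) -> provable T G p -> provable T G q
| prv_andI G p q : provable T G p -> provable T G q -> provable T G (fAnd p q)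
| prv_andEl G p q : provable T G (fAnd p q) -> provable T G p
| prv_andEr G p q : provable T G (fAnd p q) -> provable T G q
| prv_orIl G p q : provable T G p -> provable T G (fOr p q)
| prv_orIr G p q : provable T G q -> provable T G (fOr p q)
| prv_orE G p q r : provable T G (fOr p q) ->
    provable T (p :: G) r -> provable T (q :: G) r -> provable T G r
| prv_allI G p : provable T (map shift G) p -> provable T G (fAll p)
| prv_allE G p j : provable T G (fAll p) -> provable T G (inst j p)
| prv_exI G p j : provable T G (inst j p) -> provable T G (fEx p)
| prv_exE G p q : provable T G (fEx p) ->
    provable T (p :: map shift G) (shift q) -> provable T G q
| prv_eq_refl G i : provable T G (fEq i i)
| prv_eq_subst G p i j :
    provable T G (fEq i j) -> provable T G (inst i p) -> provable T G (inst j p).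

Inductive Delta0P : formula -> Prop :=
| D0P_bot : Delta0P fBot
| D0P_mem i j : Delta0P (fMem i j)
| D0P_eq i j : Delta0P (fEq i j)
| D0P_imp p q : Delta0P p -> Delta0P q -> Delta0P (fImp p q)
| D0P_and p q : Delta0P p -> Delta0P q -> Delta0P (fAnd p q)
| D0P_or p q : Delta0P p -> Delta0P q -> Delta0P (fOr p q)
| D0P_ex_in y p : Delta0P p -> Delta0P (fExIn y p)
| D0P_all_in y p : Delta0P p -> Delta0P (fAllIn y p)
| D0P_ex_sub y p : Delta0P p -> Delta0P (fExSub y p)
| D0P_all_sub y p : Delta0P p -> Delta0P (fAllSub y p).

(* The Takahashi hierarchy before closing under provable equivalence. *)
Fixpoint strict_SigmaP (n : nat) : set formula :=
  if n is m.+1 then [set fEx p | p in strict_PiP m] else Delta0P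
with strict_PiP (n : nat) : set formula :=
  if n is m.+1 then [set fAll p | p in strict_SigmaP m] else Delta0P.

(* ∀x ∀y (∀z (z ∈ x ↔ z ∈ y) → x = y) *)
Definition ax_extensionality :=
  fAll (fAll (fImp (fAll (fIff (fMem 0 2) (fMem 0 1))) (fEq 1 0))).

(* ∀u ∀v ∃x ∀w (w ∈ x ↔ w = u ∨ w = v) *)
Definition ax_pairing :=
  fAll (fAll (fEx (fAll (fIff (fMem 0 1) (fOr (fEq 0 3) (fEq 0 2)))))).

(* ∀x ∃u ∀r (r ∈ u ↔ ∃v ∈ x, r ∈ v) *)
Definition ax_union :=
  fAll (fEx (fAll (fIff (fMem 0 1) (fExIn 2 (fMem 1 0))))).

(* ∀u ∃x ∀v (v ∈ x ↔ v ⊆ u) *)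
Definition ax_powerset :=
  fAll (fEx (fAll (fIff (fMem 0 1) (fSub 0 2)))).

(* ∃x (∃e ∈ x, e = ∅ ∧ ∀u ∈ x, ∃v ∈ x, v = u ∪ {u}) *)
Definition ax_infinity :=
  fEx (fAnd (fExIn 0 (fAll (fNot (fMem 0 1))))
            (fAllIn 0 (fExIn 1 (fAll (fIff (fMem 0 1)
                                           (fOr (fMem 0 2) (fEq 0 2))))))).

(* In the schemata the free variables of [p] beyond the displayed ones are the
   parameters; the renamings move them past the quantifiers of the axiom. *)

(* ∀x ∃y ∀u (u ∈ y ↔ u ∈ x ∧ p(u)), where u is variable 0 of p *)
Definition separation_of (p : formula) :=
  fAll (fEx (fAll (fIff (fMem 0 1)
    (fAnd (fMem 0 2) (rename (scons 0 (fun k => k + 3)) p))))).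

(* ∀x (∀u ∈ x, ∃v p(u, v) → ∃y ∀u ∈ x, ∃v ∈ y, p(u, v)), where u and v are
   variables 1 and 0 of p *)
Definition collection_of (p : formula) :=
  fAll (fImp
    (fAllIn 0 (fEx (rename (scons 0 (scons 1 (fun k => k + 3))) p)))
    (fEx (fAllIn 1 (fExIn 1 (rename (scons 0 (scons 1 (fun k => k + 4))) p))))).

(* ∃x p(x) → ∃y (p(y) ∧ ∀v ∈ y, ¬ p(v)), where x is variable 0 of p *)
Definition foundation_of (p : formula) :=
  fImp (fEx p)
       (fEx (fAnd p (fAllIn 0 (fNot (rename (scons 0 (fun k => k + 2)) p))))).

Definition Separation (C : set formula) : set formula :=
  [set separation_of p | p in C].
Definition Collection (C : set formula) : set formula :=
  [set collection_of p | p in C].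
Definition Foundation (C : set formula) : set formula :=
  [set foundation_of p | p in C].

(* The schemata range over the strict classes, as provable equivalence in KPP
   is only available afterwards; KPP proves the instances for the closed ones. *)
Definition KPP : set formula :=
  [set p | p = ax_extensionality \/ p = ax_pairing \/ p = ax_union \/ p = ax_powerset \/
           p = ax_infinity]
  `|` Separation Delta0P `|` Collection Delta0P `|` Foundation (strict_PiP 1).

Definition up_to_KPP (C : set formula) : set formula :=
  [set p | exists2 q, C q & provable KPP [::] (fIff p q)].

Definition SigmaP (n : nat) : set formula := up_to_KPP (strict_SigmaP n).
Definition PiP (n : nat) : set formula := up_to_KPP (strict_PiP n).

Record structure := Structure { carrier :> Type; elt : carrier -> carrier -> Prop }.

Fixpoint sat (M : structure) (s : nat -> M) (p : formula) : Prop :=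
  match p with
  | fBot => False
  | fMem i j => elt (s i) (s j)
  | fEq i j => s i = s j
  | fImp p q => sat s p -> sat s q
  | fAnd p q => sat s p /\ sat s q
  | fOr p q => sat s p \/ sat s q
  | fAll p => forall x : M, sat (scons x s) p
  | fEx p => exists x : M, sat (scons x s) p
  end.

Definition models (M : structure) (T : set formula) : Prop :=
  forall p, T p -> forall s : nat -> M, sat s p.

Definition nonstandard (M : structure) : Prop := ~ well_founded (@elt M).

Section Internal.
Variable M : structure.
Implicit Types x y z a b c d f p : M.

Definition transitive_set x := forall y z, elt y x -> elt z y -> elt z x.

(* By Foundation, this agrees with "transitive and well-ordered by ∈". *)
Definition ordinal x :=
  transitive_set x /\ forall y, elt y x -> transitive_set y.

(* p = {a, b}, and p = (a, b) = {{a}, {a, b}}, in the sense of M *)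
Definition is_upair p a b := forall z, elt z p <-> z = a \/ z = b.
Definition is_opair p a b :=
  exists c d, [/\ is_upair c a a, is_upair d a b & is_upair p c d].

Definition maps f x y := exists2 p, is_opair p x y & elt p f.

Definition function_on f d :=
  (forall p, elt p f -> exists x y, elt x d /\ is_opair p x y) /\
  (forall x, elt x d -> exists! y, maps f x y).

(* M ⊨ rank(x) = a: some function in M on a transitive set containing x
   satisfies f(y) = ⋃ {f(z) ∪ {f(z)} | z ∈ y} and sends x to a. *)
Definition is_rank x a :=
  exists f d, [/\ transitive_set d, elt x d, function_on f d,
    (forall y b, maps f y b -> forall c, elt c b <->
       exists z e, [/\ elt z y, maps f z e & elt c e \/ c = e])
    & maps f x a].

Definition rank_le x y :=
  exists a b, [/\ is_rank x a, is_rank y b & elt a b \/ a = b].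

(* The set M_a of the elements of M of rank less than a *)
Definition rank_below a : set M :=
  [set x | exists2 b, is_rank x b & elt b a].

End Internal.

Section Embeddings.
Variables (M N : structure) (i : M -> N).

Definition embedding : Prop :=
  injective i /\ forall x y, elt x y <-> elt (i x) (i y).

Definition rank_initial : Prop :=
  forall (m : M) (n : N), rank_le n (i m) -> range i n.

Definition bounded_emb : Prop :=
  exists2 a : N, ordinal a & range i `<=` rank_below a.

Definition topless : Prop :=
  bounded_emb /\
  forall b : N, ordinal b -> ~ range i b ->
    exists b' : N, [/\ ordinal b', ~ range i b' & elt b' b].

Definition rank_initial_embedding : Prop := embedding /\ rank_initial.

Definition rank_cut : Prop := rank_initial_embedding /\ topless.

End Embeddings.

(* A common substructure S of M and N is presented as a structure together with
   its two inclusion maps. *)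
Definition common_rank_cut (S M N : structure) (jM : S -> M) (jN : S -> N) :=
  rank_cut jM /\ rank_cut jN.

Definition fixes_pointwise (S M N : structure) (jM : S -> M) (jN : S -> N)
    (i : M -> N) : Prop :=
  forall s : S, i (jM s) = jN s.

Definition Cod (S M : structure) (j : S -> M) : set (set S) :=
  range (fun c : M => [set x : S | elt (j x) c]).

Record so_structure :=
  SoStructure { so_base : structure; so_sets : set (set so_base) }.

Definition SSy (S M : structure) (j : S -> M) : so_structure :=
  SoStructure (Cod j).

(* A formula with parameters from S is a formula together with a valuation of
   its variables in S. *)
Definition Th (C : set formula) (S M : structure) (j : S -> M) :
    set (formula * (nat -> S)) :=
  [set ps | C ps.1 /\ sat (j \o ps.2) ps.1].

(* Main.v *)
Require Import Defs.
From mathcomp Require Import all_boot.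
From mathcomp Require Import boolp classical_sets cardinality.
Import Defs.

(** The argument is a back-and-forth construction in the style of Friedman's embedding
    theorem.  Where one would use a satisfaction predicate for arithmetised formulas, a
    notion of truth for set-sized positive infinitary formulas does the work.

    A formula is coded by a set.  It speaks about a tuple, that is, a finite partial function
    [f] from numerals to elements of the model.  Besides atomic codes about the entries of
    [f] there are two connectives, each applied to a set [a] of codes: [ExCode] says that
    [f] can be extended by a value so that every code of [a] becomes true, and [SubCode] that
    whichever subset of an entry of [f] is added, some code of [a] becomes true.  Codes are
    well-founded, so truth needs no recursion: a pair (code, tuple) is true exactly when it
    belongs to a set of pairs each of which is justified by pairs that are true in the same
    sense.  Such a set is called a support here.  Truth, [Sat], is therefore Sigma_1^P, by
    one formula for all models.  By Collection, supports for the members of a set of pairs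
    can be amalgamated ([collect_Sat]), so truth obeys the expected clauses although the
    connectives range over infinite sets ([Sat_Ex], [Sat_Sub]).

    For (b) => (a'), a condition consists of finitely many pairs (m, n) and a support [w] in
    N; it is valid if for every code in S that is true of the m's in M, the support [w] has
    the same code at the n's.  The inclusion of theories provides a valid condition with no
    pairs ([valid_init]).  Going forth from m, the set A of the codes in S that are true of the
    extended tuple is cut out by an element of M, by Sigma_1^P-Separation, hence also by an
    element of N.  For every v in S the set A ∩ v is in S, the code [ExCode] over A ∩ v is
    true in M, and so N has a value that is good for A ∩ v; since no ordinal of N
    is the least one outside S, overspill gives a value that is good for all of A ([forth]).
    Going back from a subset n of some earlier value is dual, with [SubCode] and overspill
    in M ([back]).  The range of the limit embedding i is then closed under subsets, which
    makes i preserve Delta_0^P-formulae in both directions and Sigma_1^P-formulae upwards;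
    as the levels of the cumulative hierarchy have a Sigma_1^P description, i is
    rank-initial.

    Toplessness comes from the ranks of the supports.  All values of i have rank below the
    rank of every support that is used, and each step forth lowers that rank.  Given an
    ordinal b of N, either some support for the current pairs has rank at most b, and a
    further step forth leads to one whose rank is below b and outside the range; or some
    single true code has no support of rank at most b, and then the image under i of a
    support in M has rank above b, so that b is in the range ([descend]).

    (a) => (b) is the preservation just mentioned, together with the remark that the range
    of i contains every subset of the image of a set of M that includes S. *)

Set Implicit Arguments.
Unset Strict Implicit.
Unset Printing Implicit Defensive.

Local Open Scope classical_set_scope.

(** * Renaming and soundness *)

Notation "x .: s" := (scons x s) (at level 55, right associativity).

Lemma sat_ext (M : structure) (p : formula) (s s' : nat -> M) :
  (forall k, s k = s' k) -> sat s p <-> sat s' p.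
Proof. by move=> /funext ->. Qed.

Lemma sat_rename (M : structure) p : forall (r : nat -> nat) (s : nat -> M),
  sat s (rename r p) <-> sat (s \o r) p.
Proof.
have aux r (s : nat -> M) x : (x .: s) \o (0 .: succn \o r) = x .: s \o r.
  by apply/funext => -[|k].
elim: p => /=.
- by [].
- by [].
- by [].
- by move=> p IHp q IHq r s; rewrite IHp IHq.
- by move=> p IHp q IHq r s; rewrite IHp IHq.
- by move=> p IHp q IHq r s; rewrite IHp IHq.
- by move=> p IH r s; split=> h x; move: (h x); rewrite IH aux.
- by move=> p IH r s; split=> -[x h]; exists x; move: h; rewrite IH aux.
Qed.

Lemma sat_rename_ext (M : structure) r p (s s' : nat -> M) :
  (forall k, s (r k) = s' k) -> sat s (rename r p) <-> sat s' p.
Proof. by move=> e; rewrite sat_rename; apply: sat_ext. Qed.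

Lemma sat_shift (M : structure) x (s : nat -> M) p :
  sat (x .: s) (shift p) <-> sat s p.
Proof. exact: sat_rename_ext. Qed.

Lemma sat_inst (M : structure) j (s : nat -> M) p :
  sat s (inst j p) <-> sat (s j .: s) p.
Proof. by apply: sat_rename_ext => -[]. Qed.

Lemma soundness (M : structure) (T : set formula) G p :
  models M T -> provable T G p ->
  forall s : nat -> M, (forall q, List.In q G -> sat s q) -> sat s p.
Proof.
move=> hM; elim: p / => {G} /=.
- by move=> G p Tp s _; apply: hM.
- by move=> G p Gp s; apply.
- move=> G p _ IH s hG; apply: contrapT => np.
  by apply: (IH s) => q [<-|/hG].
- by move=> G p q _ IH s hG sp; apply: IH => r [<-|/hG].
- by move=> G p q _ IH1 _ IH2 s hG; apply: IH1 => //; apply: IH2.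
- by move=> G p q _ IH1 _ IH2 s hG; split; [apply: IH1|apply: IH2].
- by move=> G p q _ IH s hG; case: (IH s hG).
- by move=> G p q _ IH s hG; case: (IH s hG).
- by move=> G p q _ IH s hG; left; apply: IH.
- by move=> G p q _ IH s hG; right; apply: IH.
- move=> G p q r _ IH _ IHp _ IHq s hG; case: (IH s hG) => h.
    by apply: IHp => u [<-|/hG].
  by apply: IHq => u [<-|/hG].
- move=> G p _ IH s hG x; apply: IH => q /List.in_map_iff [r [<- Gr]].
  by apply/sat_shift/hG.
- by move=> G p j _ IH s hG; apply/sat_inst/IH.
- by move=> G p j _ IH s hG; exists (s j); apply/sat_inst/IH.
- move=> G p q _ IHp _ IHq s hG; have [x px] := IHp s hG.
  apply/(sat_shift x)/IHq => r [<-//|/List.in_map_iff [u [<- Gu]]].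
  by apply/sat_shift/hG.
- by [].
- move=> G p i j _ IHe _ IHp s hG; have /sat_inst := IHp s hG.
  by rewrite (IHe s hG) => /sat_inst.
Qed.

Lemma Delta0P_rename p : Delta0P p -> forall r, Delta0P (rename r p).
Proof.
elim=> {p} /=.
- by move=> r; constructor.
- by move=> i j r; constructor.
- by move=> i j r; constructor.
- by move=> p q _ IHp _ IHq r; constructor.
- by move=> p q _ IHp _ IHq r; constructor.
- by move=> p q _ IHp _ IHq r; constructor.
- by move=> y p _ IH r; apply: (D0P_ex_in (r y)).
- by move=> y p _ IH r; apply: (D0P_all_in (r y)).
- by move=> y p _ IH r; apply: (D0P_ex_sub (r y)).
- by move=> y p _ IH r; apply: (D0P_all_sub (r y)).
Qed.

(** * The axioms read in a model *)

Definition KPPS : set formula := KPP `|` Separation (SigmaP 1).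

Definition subset_of (M : structure) (x y : M) := forall z, elt z x -> elt z y.

Section FirstConsequences.
Variables (M : structure) (hM : models M KPPS).
Implicit Types (x y z u v : M) (s : nat -> M).

Lemma KPP_KPPS : models M KPP.
Proof. by move=> p hp; apply: hM; left. Qed.

Lemma elt_ext x y : (forall z, elt z x <-> elt z y) -> x = y.
Proof.
have /(_ (fun=> x) x y) /= h := KPP_KPPS (or_introl (or_introl (or_introl (or_introl erefl)))).
by move=> e; apply: h => z; split=> /e.
Qed.

Lemma ax_upair u v : exists x, is_upair x u v.
Proof.
have /(_ (fun=> u) u v) /= [x hx] :=
  KPP_KPPS (or_introl (or_introl (or_introl (or_intror (or_introl erefl))))).
by exists x => w; split=> /hx.
Qed.

Lemma ax_bigcup x : exists u, forall r, elt r u <-> exists2 v, elt v x & elt r v.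
Proof.
have /(_ (fun=> x) x) /= [u hu] :=
  KPP_KPPS (or_introl (or_introl (or_introl (or_intror (or_intror (or_introl erefl)))))).
by exists u => r; split=> [/hu [v []]|[v vx rv]]; [exists v|apply/hu; exists v].
Qed.

Lemma ax_pow x : exists u, forall v, elt v u <-> subset_of v x.
Proof.
have /(_ (fun=> x) x) /= [u hu] :=
  KPP_KPPS (or_introl (or_introl (or_introl
    (or_intror (or_intror (or_intror (or_introl erefl))))))).
by exists u => v; split=> /hu.
Qed.

Lemma sep_SigmaP p s x : SigmaP 1 p ->
  exists y, forall u, elt u y <-> elt u x /\ sat (u .: s) p.
Proof.
move=> hp; have /(_ s x) /= [y hy] := hM (or_intror (imageP separation_of hp)).
have e u : sat (u .: y .: x .: s) (rename (0 .: addn^~ 3) p) <-> sat (u .: s) p.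
  by apply: sat_rename_ext => -[//|k] /=; rewrite addn3.
exists y => u; split=> [/hy [ux /e]//|[ux h]].
by apply/hy; split=> //; apply/e.
Qed.

Lemma collection_Delta0P p s x : Delta0P p ->
  (forall u, elt u x -> exists v, sat (v .: u .: s) p) ->
  exists y, forall u, elt u x -> exists2 v, elt v y & sat (v .: u .: s) p.
Proof.
move=> hp h; have /(_ s x) /= [] :=
    KPP_KPPS (or_introl (or_intror (imageP collection_of hp))).
  move=> u /h [v hv]; exists v; apply: (iffRL (sat_rename_ext _ _)) hv.
  by case=> [|[|k]] //=; rewrite addn3.
move=> y hy; exists y => u /hy [v [vy hv]]; exists v => //.
apply: (iffLR (sat_rename_ext _ _)) hv => -[|[|k]] //=.
by rewrite addn4.
Qed.

Lemma foundation_Pi1P p s x : Delta0P p -> (forall z, sat (z .: x .: s) p) ->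
  exists y, (forall z, sat (z .: y .: s) p) /\
    forall v, elt v y -> exists z, ~ sat (z .: v .: s) p.
Proof.
move=> hp h.
have hq : strict_PiP 1 (fAll p) by exists p.
have /(_ s) /= [] := KPP_KPPS (or_intror (imageP foundation_of hq)).
  by exists x.
move=> y [hy1 hy2]; exists y; split=> // v vy; apply: contrapT => n.
apply: (hy2 v vy) => z; apply: contrapT => nz; apply: n; exists z => hz; apply: nz.
apply: (iffRL (sat_rename_ext _ _)) hz => -[|[|k]] //=.
by rewrite addn2.
Qed.

End FirstConsequences.

(** * Uniformly definable predicates *)

(** Definability is handled semantically: a predicate is given in all structures at once, and
    it is definable if one formula defines it everywhere.  The uniformity in the structure is
    what allows a predicate to be transferred from one model to another. *)
Definition predicate := forall M : structure, (nat -> M) -> Prop.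

(** The defining formula works in every structure, in particular in the common substructure
    S, which need not satisfy any of the axioms. *)
Definition D0 (P : predicate) :=
  exists2 p, Delta0P p & forall (M : structure) (s : nat -> M), P M s <-> sat s p.

(** Here the formula is only required to work in models of the theory, so that closure under
    bounded quantifiers can be obtained from Collection. *)
Definition S1 (P : predicate) := exists2 p, Delta0P p &
  forall M : structure, models M KPPS -> forall s : nat -> M, P M s <-> exists x, sat (x .: s) p.

(** The valuation seen under a binder: the bound element is entry 0, the rest is shifted. *)
Definition tl (T : Type) (s : nat -> T) (k : nat) := s k.+1.

Section Delta0.
Implicit Types (P Q : predicate) (i j y : nat).

Lemma D0_equiv P Q : (forall (M : structure) (s : nat -> M), Q M s <-> P M s) -> D0 P -> D0 Q.
Proof. by move=> e [p hp h]; exists p => // M s; rewrite e h. Qed.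

Lemma D0_mem i j : D0 (fun M s => elt (s i) (s j)).
Proof. by exists (fMem i j); [constructor|]. Qed.

Lemma D0_eq i j : D0 (fun M s => s i = s j).
Proof. by exists (fEq i j); [constructor|]. Qed.

Lemma D0_False : D0 (fun M s => False).
Proof. by exists fBot; [constructor|]. Qed.

Lemma D0_imp P Q : D0 P -> D0 Q -> D0 (fun M s => P M s -> Q M s).
Proof.
move=> [p hp P_p] [q hq Q_q]; exists (fImp p q); first by constructor.
by move=> M s; rewrite P_p Q_q.
Qed.

Lemma D0_and P Q : D0 P -> D0 Q -> D0 (fun M s => P M s /\ Q M s).
Proof.
move=> [p hp P_p] [q hq Q_q]; exists (fAnd p q); first by constructor.
by move=> M s; rewrite P_p Q_q.
Qed.

Lemma D0_or P Q : D0 P -> D0 Q -> D0 (fun M s => P M s \/ Q M s).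
Proof.
move=> [p hp P_p] [q hq Q_q]; exists (fOr p q); first by constructor.
by move=> M s; rewrite P_p Q_q.
Qed.

Lemma D0_not P : D0 P -> D0 (fun M s => ~ P M s).
Proof. by move=> hP; apply: D0_imp hP D0_False. Qed.

Lemma D0_iff P Q : D0 P -> D0 Q -> D0 (fun M s => P M s <-> Q M s).
Proof. by move=> hP hQ; apply: D0_and; apply: D0_imp. Qed.

Lemma D0_all_in y (R : forall M : structure, M -> (nat -> M) -> Prop) :
  D0 (fun M s => R M (s 0) (tl s)) ->
  D0 (fun M s => forall x, elt x (s y) -> R M x s).
Proof.
move=> [p hp R_p]; exists (fAllIn y p); first by constructor.
by move=> M s; split=> /= h x /h /(R_p M (x .: s)).
Qed.

Lemma D0_ex_in y (R : forall M : structure, M -> (nat -> M) -> Prop) :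
  D0 (fun M s => R M (s 0) (tl s)) ->
  D0 (fun M s => exists x, elt x (s y) /\ R M x s).
Proof.
move=> [p hp R_p]; exists (fExIn y p); first by constructor.
by move=> M s; split=> /= -[x [xy /(R_p M (x .: s)) h]]; exists x.
Qed.

Lemma D0_all_sub y (R : forall M : structure, M -> (nat -> M) -> Prop) :
  D0 (fun M s => R M (s 0) (tl s)) ->
  D0 (fun M s => forall x, subset_of x (s y) -> R M x s).
Proof.
move=> [p hp R_p]; exists (fAllSub y p); first by constructor.
by move=> M s; split=> /= h x /h /(R_p M (x .: s)).
Qed.

Lemma D0_subset i j : D0 (fun M s => subset_of (s i) (s j)).
Proof. exact: D0_all_in (D0_mem 0 j.+1). Qed.

End Delta0.

(** Descends through the logical symbols of a predicate, using the hint database for the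
    set-theoretic notions. *)
Ltac d0 := rewrite /tl /=; lazymatch goal with
  | |- D0 (fun M s => exists x, elt x _ /\ _) => apply: D0_ex_in; d0
  | |- D0 (fun M s => forall x, elt x _ -> _) => apply: D0_all_in; d0
  | |- D0 (fun M s => forall x, subset_of x _ -> _) => apply: D0_all_sub; d0
  | |- D0 (fun M s => _ <-> _) => apply: D0_iff; d0
  | |- D0 (fun M s => _ /\ _) => apply: D0_and; d0
  | |- D0 (fun M s => _ \/ _) => apply: D0_or; d0
  | |- D0 (fun M s => ~ _) => apply: D0_not; d0
  | |- D0 (fun M s => False) => apply: D0_False
  | |- D0 (fun M s => elt _ _) => apply: D0_mem
  | |- D0 (fun M s => _ = _) => apply: D0_eq
  | |- D0 (fun M s => _ -> _) => apply: D0_imp; d0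
  | |- _ => try solve [auto with d0]
  end.

#[export] Hint Resolve D0_subset : d0.

Lemma D0_transitive_set i : D0 (fun M s => transitive_set (s i)).
Proof.
apply: (@D0_equiv (fun M s => forall y, elt y (s i) -> forall z, elt z y -> elt z (s i))).
  by move=> M s; split=> h y; [move=> yi z zy; apply: h zy|move=> z yi zy; apply: h zy].
by d0.
Qed.
#[export] Hint Resolve D0_transitive_set : d0.

Lemma D0_ordinal i : D0 (fun M s => ordinal (s i)).
Proof. by rewrite /ordinal; d0. Qed.

Lemma D0_is_upair i j k : D0 (fun M s => is_upair (s i) (s j) (s k)).
Proof.
apply: (@D0_equiv (fun M s => elt (s j) (s i) /\ elt (s k) (s i) /\
  forall x, elt x (s i) -> x = s j \/ x = s k)); last by d0.
move=> M s; split=> [h|[h1 [h2 h3]] z].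
  by split; [|split]; [apply/h; left|apply/h; right|move=> x /h].
by split=> [/h3//|[->|->]].
Qed.
#[export] Hint Resolve D0_ordinal D0_is_upair : d0.

(** The components of a pair lie in members of the pair, so that a quantifier over them is
    bounded. *)
Lemma opair_bounded (M : structure) (p a b : M) : is_opair p a b ->
  exists c d, [/\ elt c p, elt d p, elt a c & elt b d].
Proof.
by move=> [c [d [hc hd hp]]]; exists c, d; split; [apply/hp; left|apply/hp; right|
  apply/hc; left|apply/hd; right].
Qed.

Lemma D0_is_opair i j k : D0 (fun M s => is_opair (s i) (s j) (s k)).
Proof.
apply: (@D0_equiv (fun M s => exists c, elt c (s i) /\ exists d, elt d (s i) /\
  (is_upair c (s j) (s j) /\ is_upair d (s j) (s k) /\ is_upair (s i) c d))); last by d0.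
move=> M s; split=> [[c [d [hc hd hp]]]|[c [_ [d [_ [hc [hd hp]]]]]]].
  by exists c; split; [apply/hp; left|exists d; split; [apply/hp; right|]].
by exists c, d.
Qed.
#[export] Hint Resolve D0_is_opair : d0.

Lemma D0_maps i j k : D0 (fun M s => maps (s i) (s j) (s k)).
Proof.
apply: (@D0_equiv (fun M s => exists p, elt p (s i) /\ is_opair p (s j) (s k))); last by d0.
by move=> M s; split=> [[p hp pi]|[p [pi hp]]]; exists p.
Qed.
#[export] Hint Resolve D0_maps : d0.

Section Sigma1.
Implicit Types (P Q : predicate) (i j y : nat).

Lemma S1_equiv P Q :
  (forall M : structure, models M KPPS -> forall s : nat -> M, Q M s <-> P M s) ->
  S1 P -> S1 Q.
Proof. by move=> e [p hp h]; exists p => // M hM s; rewrite e // h. Qed.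

Lemma S1_D0 P : D0 P -> S1 P.
Proof.
move=> [p hp h]; exists (shift p); first exact: Delta0P_rename.
by move=> M _ s; rewrite h; split=> [hs|[x /sat_shift//]]; exists (s 0); apply/sat_shift.
Qed.

(** Two unbounded existential quantifiers are merged by bounding both by an unordered pair. *)
Lemma S1_ex (R : forall M : structure, M -> (nat -> M) -> Prop) :
  S1 (fun M s => R M (s 0) (tl s)) -> S1 (fun M s => exists x, R M x s).
Proof.
move=> [p hp h].
exists (fExIn 0 (fExIn 1 (rename (0 .: 1 .: addn 3) p))).
  by do 2 constructor; apply: Delta0P_rename.
move=> M hM s.
have e z x u : sat (z .: x .: u .: s) (rename (0 .: 1 .: addn 3) p) <->
    sat (z .: x .: s) p by apply: sat_rename_ext => -[|[|k]].
split=> [[x /(h M hM (x .: s)) [z hz]]|/= [u [x [_ [z [_ /e hz]]]]]].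
  have [u hu] := ax_upair hM x z.
  exists u, x; split; first by apply/hu; left.
  by exists z; split; [apply/hu; right|apply/e].
by exists x; apply/(h M hM (x .: s)); exists z.
Qed.

Lemma S1_and P Q : S1 P -> S1 Q -> S1 (fun M s => P M s /\ Q M s).
Proof.
move=> [p hp hP] [q hq hQ].
exists (fAnd (fExIn 0 (rename (0 .: addn 2) p)) (fExIn 0 (rename (0 .: addn 2) q))).
  by do 2 constructor; apply: Delta0P_rename.
move=> M hM s.
have e r x u : sat (x .: u .: s) (rename (0 .: addn 2) r) <-> sat (x .: s) r.
  by apply: sat_rename_ext => -[|k].
rewrite hP // hQ //; split=> [[[x hx] [y hy]]|/= [u [[x [_ /e hx]] [y [_ /e hy]]]]].
  have [u hu] := ax_upair hM x y; exists u; split.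
    by exists x; split; [apply/hu; left|apply/e].
  by exists y; split; [apply/hu; right|apply/e].
by split; [exists x|exists y].
Qed.

Lemma S1_or P Q : S1 P -> S1 Q -> S1 (fun M s => P M s \/ Q M s).
Proof.
move=> [p hp hP] [q hq hQ]; exists (fOr p q); first by constructor.
move=> M hM s; rewrite hP // hQ //.
by split=> [[[x]|[x]]|/= [x []]]; [exists x; left|exists x; right|left; exists x|right; exists x].
Qed.

(** Collection moves the unbounded quantifier in front of the bounded one. *)
Lemma S1_all_in y (R : forall M : structure, M -> (nat -> M) -> Prop) :
  S1 (fun M s => R M (s 0) (tl s)) ->
  S1 (fun M s => forall x, elt x (s y) -> R M x s).
Proof.
move=> [p hp h].
exists (fAllIn y.+1 (fExIn 1 (rename (0 .: 1 .: addn 3) p))).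
  by do 2 constructor; apply: Delta0P_rename.
move=> M hM s.
have e z x u : sat (z .: x .: u .: s) (rename (0 .: 1 .: addn 3) p) <->
    sat (z .: x .: s) p by apply: sat_rename_ext => -[|[|k]].
split=> [H|/= [u hu] x /hu [z [_ /e hz]]]; last by apply/(h M hM (x .: s)); exists z.
have [|u hu] := @collection_Delta0P M hM p s (s y) hp.
  by move=> x /H /(h M hM (x .: s)).
by exists u => /= x /hu [z zu hz]; exists z; split=> //; apply/e.
Qed.

(** As for bounded quantification over elements, with Collection applied on the power set. *)
Lemma S1_all_sub y (R : forall M : structure, M -> (nat -> M) -> Prop) :
  S1 (fun M s => R M (s 0) (tl s)) ->
  S1 (fun M s => forall x, subset_of x (s y) -> R M x s).
Proof.
move=> [p hp h].
exists (fAllSub y.+1 (fExIn 1 (rename (0 .: 1 .: addn 3) p))).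
  by do 2 constructor; apply: Delta0P_rename.
move=> M hM s.
have e z x u : sat (z .: x .: u .: s) (rename (0 .: 1 .: addn 3) p) <->
    sat (z .: x .: s) p by apply: sat_rename_ext => -[|[|k]].
split=> [H|/= [u hu] x /hu [z [_ /e hz]]]; last by apply/(h M hM (x .: s)); exists z.
have [P hP] := ax_pow hM (s y).
have [|u hu] := @collection_Delta0P M hM p s P hp.
  by move=> x /hP /H /(h M hM (x .: s)).
by exists u => /= x /hP/hu [z zu hz]; exists z; split=> //; apply/e.
Qed.

Lemma S1_imp P Q : D0 P -> S1 Q -> S1 (fun M s => P M s -> Q M s).
Proof.
move=> hP hQ; apply: (@S1_equiv (fun M s => ~ P M s \/ Q M s)).
  by move=> M hM s; split=> [h|[]//]; have [/h|] := EM (P M s); [right|left].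
by apply: S1_or => //; apply/S1_D0/D0_not.
Qed.

Lemma S1_all_opair i (R : forall M : structure, M -> M -> (nat -> M) -> Prop) :
  S1 (fun M s => R M (s 1) (s 0) (tl (tl s))) ->
  S1 (fun M s => forall a b, is_opair (s i) a b -> R M a b s).
Proof.
move=> [p hp h].
apply: (@S1_equiv (fun M s => forall c, elt c (s i) -> forall a, elt a c ->
  forall d, elt d (s i) -> forall b, elt b d -> is_opair (s i) a b -> R M a b s)).
  move=> M hM s; split=> [H c _ a _ d _ b _ /H//|H a b hab].
  by have [c [d [hc hd hac hbd]]] := opair_bounded hab; apply: (H c _ a _ d _ b).
do 4![apply: S1_all_in; rewrite /tl /=].
apply: S1_imp; first exact: D0_is_opair.
exists (rename (0 .: 1 .: 3 .: addn 5) p); first exact: Delta0P_rename.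
move=> M hM s; rewrite /= (h M hM (s 0 .: s 2 .: tl (tl (tl (tl s))))).
have e x : sat (x .: s) (rename (0 .: 1 .: 3 .: addn 5) p) <->
    sat (x .: s 0 .: s 2 .: tl (tl (tl (tl s)))) p.
  by apply: sat_rename_ext => -[|[|[|k]]].
by split=> -[x /e hx]; exists x.
Qed.

Lemma S1_all_maps i (R : forall M : structure, M -> M -> (nat -> M) -> Prop) :
  S1 (fun M s => R M (s 1) (s 0) (tl (tl (tl s)))) ->
  S1 (fun M s => forall a b, maps (s i) a b -> R M a b s).
Proof.
move=> hR; apply: (@S1_equiv (fun M s => forall p, elt p (s i) ->
    forall a b, is_opair p a b -> R M a b s)).
  by move=> M hM s; split=> [H p pi a b hp|H a b [p hp pi]]; [apply: H; exists p|apply: H hp].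
apply: S1_all_in; rewrite /tl; apply: S1_all_opair; exact: hR.
Qed.

End Sigma1.

Ltac s1 := rewrite /tl /=; lazymatch goal with
  | |- S1 (fun M s => ex _) => apply: S1_ex; s1
  | |- S1 (fun M s => forall x, elt x _ -> _) => apply: S1_all_in; s1
  | |- S1 (fun M s => forall x, subset_of x _ -> _) => apply: S1_all_sub; s1
  | |- S1 (fun M s => forall a b, is_opair _ a b -> _) => apply: S1_all_opair; s1
  | |- S1 (fun M s => forall a b, maps _ a b -> _) => apply: S1_all_maps; s1
  | |- S1 (fun M s => _ /\ _) => apply: S1_and; s1
  | |- S1 (fun M s => _ \/ _) => apply: S1_or; s1
  | |- S1 (fun M s => elt _ _) => apply/S1_D0/D0_mem
  | |- S1 (fun M s => _ = _) => apply/S1_D0/D0_eq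
  | |- S1 (fun M s => False) => apply/S1_D0/D0_False
  | |- S1 (fun M s => ~ _) => apply/S1_D0; d0
  | |- S1 (fun M s => _ -> _) => apply: S1_imp; [d0|s1]
  | |- _ => first [solve [auto with s1] | apply/S1_D0; solve [auto with d0] | idtac]
  end.

(** * Separation, Collection and induction for Sigma_1^P predicates *)

Section Schemata.
Variables (M : structure) (hM : models M KPPS).
Implicit Types (x y u v : M) (s : nat -> M).

Lemma provable_iff_refl T G p : provable T G (fIff p p).
Proof. by apply: prv_andI; apply: prv_impI; apply: prv_hyp; left. Qed.

Lemma sep_S1 (R : predicate) s x : S1 R ->
  exists y, forall u, elt u y <-> elt u x /\ R M (u .: s).
Proof.
move=> [p hp h]; have [|y hy] := @sep_SigmaP M hM (fEx p) s x.
  by exists (fEx p); [exists p|apply: provable_iff_refl].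
by exists y => u; rewrite hy (h M hM).
Qed.

(** The Delta_0^P schema is applied to pairs of a value and a witness for it. *)
Lemma collection_S1 (R : predicate) s x : S1 R ->
  (forall u, elt u x -> exists v, R M (v .: u .: s)) ->
  exists y, forall u, elt u x -> exists2 v, elt v y & R M (v .: u .: s).
Proof.
move=> [p hp h] H.
have e z v u w : sat (z .: v .: w .: u .: s) (rename (0 .: 1 .: addn 3) p) <->
  sat (z .: v .: u .: s) p by apply: sat_rename_ext => -[|[|k]].
have [||y hy] := @collection_Delta0P M hM
  (fExIn 0 (fExIn 1 (rename (0 .: 1 .: addn 3) p))) s x.
- by do 2 constructor; apply: Delta0P_rename.
- move=> u /H [v /(h M hM) [z hz]]; have [w hw] := ax_upair hM v z; exists w => /=.
  exists v; split; first by apply/hw; left.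
  by exists z; split; [apply/hw; right|apply/e].
have [y' hy'] := ax_bigcup hM y.
exists y' => u /hy [w wy /= [v [vw [z [_ /e hz]]]]]; exists v; last by apply/h => //; exists z.
by apply/hy'; exists w.
Qed.

(** Foundation for the Pi_1^P negation. *)
Lemma induction_S1 (R : predicate) s : S1 R ->
  (forall x, (forall y, elt y x -> R M (y .: s)) -> R M (x .: s)) ->
  forall x, R M (x .: s).
Proof.
move=> [p hp h] IH x; apply: contrapT => nRx.
have e z w : sat (z .: w .: s) (fNot p) <-> ~ sat (z .: w .: s) p by [].
have [||y [hy1 hy2]] := @foundation_Pi1P M hM (fNot p) s x.
- by apply: D0P_imp hp D0P_bot.
- by move=> z hz; apply: nRx; apply/h => //; exists z.
have /h []// : R M (y .: s).
  apply: IH => v /hy2 [z /= hz]; apply/h => //; exists z; exact: contrapT.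
Qed.

End Schemata.

(** * Pairs, transitive closures and induction *)

Section SetTheory.
Variables (M : structure) (hM : models M KPPS).
Implicit Types (x y z u v a b c d f p q t w : M).

(** Separation holds for the Boolean combinations of Sigma_1^P predicates; this is the
    closure property that is needed, and it does not mention formulas. *)
Definition separable (P : M -> Prop) :=
  forall x, exists y, forall u, elt u y <-> elt u x /\ P u.

Lemma separable_S1 (R : predicate) s : S1 R -> separable (fun u => R M (u .: s)).
Proof. by move=> hR x; exact: sep_S1. Qed.

Lemma separable_equiv (P Q : M -> Prop) : (forall u, Q u <-> P u) -> separable P -> separable Q.
Proof. by move=> e hP x; have [y hy] := hP x; exists y => u; rewrite hy e. Qed.

Lemma separable_not P : separable P -> separable (fun u => ~ P u).
Proof.
move=> hP x; have [y hy] := hP x.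
have [z hz] := @sep_S1 M hM (fun M s => ~ elt (s 0) (s 1)) (y .: fun=> x) x
  ltac:(by s1).
exists z => u; rewrite hz /= hy; split=> -[ux h]; split=> //; first by move=> Pu; apply: h.
by case.
Qed.

Lemma empty_ex x : exists e, forall z, ~ elt z e.
Proof.
have [y hy] := @sep_S1 M hM (fun M s => False) (fun=> x) x ltac:(by apply/S1_D0; d0).
by exists y => z /hy [].
Qed.

Lemma upair_uniq p q a b : is_upair p a b -> is_upair q a b -> p = q.
Proof. by move=> hp hq; apply: (elt_ext hM) => z; rewrite hp hq. Qed.

Lemma cup_ex x y : exists u, forall z, elt z u <-> elt z x \/ elt z y.
Proof.
have [p hp] := ax_upair hM x y; have [u hu] := ax_bigcup hM p.
exists u => z; rewrite hu; split=> [[v /hp [->|->]]|[zx|zy]]; [by left|by right| |].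
  by exists x => //; apply/hp; left.
by exists y => //; apply/hp; right.
Qed.

Lemma adjoin_ex x a : exists u, forall z, elt z u <-> elt z x \/ z = a.
Proof.
have [p hp] := ax_upair hM a a; have [u hu] := cup_ex x p.
by exists u => z; rewrite hu hp; split=> -[]; auto; case; auto.
Qed.

Lemma opair_ex a b : exists p, is_opair p a b.
Proof.
have [c hc] := ax_upair hM a a; have [d hd] := ax_upair hM a b.
by have [p hp] := ax_upair hM c d; exists p, c, d.
Qed.

Definition pr a b := projT1 (cid (opair_ex a b)).

Lemma prP a b : is_opair (pr a b) a b.
Proof. by rewrite /pr; case: cid. Qed.

Lemma is_opairE p a b : is_opair p a b <-> p = pr a b.
Proof.
split=> [|->]; last exact: prP.
move=> [c [d [hc hd hp]]]; have [c' [d' [hc' hd' hp']]] := prP a b.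
rewrite (upair_uniq hc hc') (upair_uniq hd hd') in hp; exact: upair_uniq hp hp'.
Qed.

Lemma pr_inj a b a' b' : pr a b = pr a' b' -> a = a' /\ b = b'.
Proof.
move=> e; have [c [d [hc hd hp]]] := prP a b.
have [c' [d' [hc' hd' hp']]] := prP a' b'; rewrite -{}e in hp'.
have aa : a = a'.
  have [|e|e] := (iffLR (hp' c)); first by apply/hp; left.
    by have [|->|->] := iffLR (hc' a); rewrite // -e; apply/hc; left.
  by have [|->|->] := iffLR (hc a'); rewrite // e; apply/hd'; left.
subst a'; split=> //.
have hbd : elt b d by apply/hd; right.
have hbd' : elt b' d' by apply/hd'; right.
have [|e|e] := iffLR (hp' d); first by apply/hp; right.
  have ba : b = a by rewrite e in hbd; case/hc': hbd.
  subst b; have [|e'|e'] := iffLR (hp d'); first by apply/hp'; right.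
    by rewrite e' in hbd'; case/hc: hbd' => ->.
  by rewrite e' in hbd'; case/hd: hbd' => ->.
rewrite -e in hbd'; case/hd: hbd' => // e'; subst b'.
by rewrite e in hbd; case/hd': hbd.
Qed.

Lemma mapsE f x y : maps f x y <-> elt (pr x y) f.
Proof.
by split=> [[p /is_opairE -> //]|h]; exists (pr x y) => //; exact: prP.
Qed.

(** By Sigma_1^P-induction: transitive sets around the members of x are collected into one. *)
Lemma transitive_closure x : exists t, transitive_set t /\ subset_of x t.
Proof.
apply: (@induction_S1 M hM
  (fun M s => exists t : M, transitive_set t /\ subset_of (s 0) t) (fun=> x) _ _ x); first by s1.
move=> {}x /= IH.
have [Y hY] := @collection_S1 M hM
  (fun M s => transitive_set (s 0) /\ subset_of (s 1) (s 0)) (fun=> x) x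
  ltac:(by s1) IH.
have [Z hZ] := @sep_S1 M hM (fun M s => transitive_set (s 0)) (fun=> x) Y ltac:(by s1).
have [U hU] := ax_bigcup hM Z; have [t ht] := cup_ex x U.
exists t; split; last by move=> z zx; apply/ht; left.
move=> y z /ht yt zy; apply/ht; right; apply/hU; case: yt => [yx|/hU [w /hZ [wY wt] yw]].
  have [w wY /= [wt yw]] := hY y yx; exists w; last exact: yw.
  by apply/hZ.
by exists w; [apply/hZ|apply: wt yw zy].
Qed.

(** The failures of P in a transitive set around x form a set, to which Foundation applies. *)
Lemma induction_separable (P : M -> Prop) : separable P ->
  (forall x, (forall y, elt y x -> P y) -> P x) -> forall x, P x.
Proof.
move=> hP IH x; have [t [tt xt]] := transitive_closure x.
have [y hy] := separable_not hP t.
apply: (IH) => z /xt zt; apply: contrapT => nPz.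
have zy : elt z y by apply/hy.
suff : ~ elt z y by [].
apply: (@induction_S1 M hM (fun M s => ~ elt (s 0) (s 1)) (y .: fun=> x) _ _ z); first by s1.
move=> {zt nPz zy} z /= H /hy [zt nPz].
apply: nPz; apply: IH => u uz; apply: contrapT => nPu.
by apply: (H u uz); apply/hy; split=> //; apply: tt zt uz.
Qed.

Lemma elt_irrefl x : ~ elt x x.
Proof.
apply: (@induction_S1 M hM (fun M s => ~ elt (s 0) (s 0)) (fun=> x) _ _ x); first by s1.
by move=> {}x /= IH xx; apply: IH (xx) xx.
Qed.

End SetTheory.

(** * Ranks and ordinals *)

(** The uniqueness and the recursion equation in the definition of a rank quantify over all
    sets; they are rephrased with quantifiers over the pairs that belong to the function. *)
Lemma S1_is_rank i j : S1 (fun M s => is_rank (s i) (s j)).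
Proof.
pose P : predicate := fun M s => exists (f d : M), transitive_set d /\ (elt (s i) d /\
  ((forall p : M, elt p f -> exists (x y : M), elt x d /\ is_opair p x y) /\
  ((forall x : M, elt x d -> exists y : M, maps f x y) /\
  ((forall (x y : M), maps f x y -> forall (x' y' : M), maps f x' y' -> x = x' -> y = y') /\
  ((forall (y b : M), maps f y b -> (forall c : M, elt c b -> exists z : M, elt z y /\ exists e : M,
       maps f z e /\ (elt c e \/ c = e)) /\
     (forall (z e : M), maps f z e -> elt z y -> elt e b /\ forall c : M, elt c e -> elt c b)) /\
  maps f (s i) (s j)))))).
apply: (@S1_equiv P); last by rewrite /P; s1.
move=> M hM s; split.
  move=> [f [d [td xd [f1 f2] f3 f4]]]; exists f, d.
  do 4 split=> //; first by move=> x /f2 [y [hy _]]; exists y.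
  split; [|split=> //].
    move=> x y hxy x' y' hxy' e; subst x'.
    have [x0 [y0 [x0d /(is_opairE hM) e]]] : exists x0 y0, elt x0 d /\ is_opair (pr hM x y) x0 y0.
      by apply/f1/mapsE.
    have [xx yy] := pr_inj e; subst x0 y0.
    by have [y1 [_ hy1]] := f2 x x0d; rewrite -(hy1 _ hxy) -(hy1 _ hxy').
  move=> y b hyb; split.
    by move=> c /(f3 _ _ hyb) [z [e [zy ze ce]]]; exists z; split=> //; exists e.
  move=> z e ze zy; split=> [|c ce]; apply/(f3 _ _ hyb); exists z, e; split=> //.
    by right.
  by left.
move=> [f [d [td [xd [f1 [f2 [f3 [f4 f5]]]]]]]]; exists f, d; split=> //.
  split=> // x /f2 [y xy]; exists y; split=> // y' xy'; exact: f3 xy _ _ xy' erefl.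
move=> y b hyb c; have [h1 h2] := f4 _ _ hyb; split.
  by move=> /h1 [z [zy [e [ze ce]]]]; exists z, e.
by move=> [z [e [zy ze ce]]]; have [h3 h4] := h2 _ _ ze zy; case: ce => [/h4|->].
Qed.
#[export] Hint Resolve S1_is_rank : s1.

Section Rank.
Variables (M : structure) (hM : models M KPPS).
Implicit Types (x y z u v a b c d e f p q t w : M).

(** Two rank functions agree on common arguments, by induction on the argument. *)
Lemma is_rank_uniq x a b : is_rank x a -> is_rank x b -> a = b.
Proof.
move: a b; apply: (@induction_separable M hM
    (fun x => forall a b, is_rank x a -> is_rank x b -> a = b) _ _ x).
  apply: (@separable_equiv _ (fun x => ~ exists a b, is_rank x a /\ (is_rank x b /\ a <> b))).
    move=> u; split=> [h [a [b [ha [hb ab]]]]|h a b ha hb]; first by apply/ab/h.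
    by apply: contrapT => ab; apply: h; exists a, b.
  apply: separable_not => //.
  apply: (@separable_S1 M hM (fun M s => exists (a b : M), is_rank (s 0) a /\
    (is_rank (s 0) b /\ a <> b)) (fun=> x)); by s1.
move=> {}x IH.
have sub a b : is_rank x a -> is_rank x b -> forall c, elt c a -> elt c b.
  move=> [f [d [td xd hf f3 f4]]] [g [d' [td' xd' hg g3 g4]]] c.
  move=> /(f3 _ _ f4) [z [e [zx ze ce]]]; apply/(g3 _ _ g4).
  have zd : elt z d by apply: td xd zx.
  have zd' : elt z d' by apply: td' xd' zx.
  have [e' [ze' _]] := hg.2 z zd'; exists z, e'; split=> //.
  have <- // : e = e'.
  by apply: (IH z zx); [exists f, d|exists g, d'].
by move=> a b ha hb; apply: (elt_ext hM) => c; split; apply: sub.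
Qed.

Lemma is_rank_rec x b : is_rank x b -> forall c, elt c b <->
  exists z e, [/\ elt z x, is_rank z e & elt c e \/ c = e].
Proof.
move=> [f [d [td xd hf f3 f4]]] c; split=> [/(f3 _ _ f4) [z [e [zx ze ce]]]|].
  by exists z, e; split=> //; exists f, d; split=> //; apply: td xd zx.
move=> [z [e [zx ze ce]]]; apply/(f3 _ _ f4).
have zd : elt z d by apply: td xd zx.
have [e' [ze' _]] := hf.2 z zd; exists z, e'; split=> //.
have <- // : e = e'.
by apply: is_rank_uniq ze _; exists f, d.
Qed.

(** By Sigma_1^P-induction: if all members of x have a rank, then so do all elements of a
    transitive set d that includes x, since a witness for a member serves all elements of its
    domain.  The ranks on d form a function by Collection, and x is added to it. *)
Lemma rank_ex x : exists a, is_rank x a.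
Proof.
apply: (@induction_S1 M hM (fun M s => exists a : M, is_rank (s 0) a) (fun=> x) _ _ x); first by s1.
move=> {}x /= IH.
pose R : predicate := fun M s => transitive_set (s 0) /\
  (elt (s 1) (s 0) /\ forall z : M, elt z (s 0) -> exists b : M, is_rank z b).
have [||Y hY] := @collection_S1 M hM R (fun=> x) x; first by rewrite /R; s1.
  move=> y /IH [b [f [d [td yd hf f3 f4]]]]; exists d; split=> //=; split=> // z zd.
  by have [e [ze _]] := hf.2 z zd; exists e, f, d.
have [Z hZ] := @sep_S1 M hM (fun M s => transitive_set (s 0) /\
  forall z : M, elt z (s 0) -> exists b : M, is_rank z b) (fun=> x) Y ltac:(by s1).
(* [d] is a transitive set that includes [x], all of whose elements have a rank. *)
have [d hd] := ax_bigcup hM Z.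
have xd y : elt y x -> elt y d.
  move=> yx; apply/hd; have [w wY /= [tw [yw rw]]] := hY y yx.
  by exists w => //; apply/hZ.
have td : transitive_set d.
  move=> y z /hd [w /hZ /= [wY [tw rw]] yw] zy; apply/hd.
  by exists w; [apply/hZ|apply: tw yw zy].
have rd z : elt z d -> exists b, is_rank z b by move=> /hd [w /hZ [_ [_]]]; apply.
have [/rd //|nxd] := EM (elt x d).
have [d' hd'] := adjoin_ex hM d x.
have td' : transitive_set d'.
  move=> y z /hd' [yd|->] zy; apply/hd'; left; [exact: td yd zy|exact: xd].
have [||F hF] := @collection_S1 M hM
  (fun M s => exists b : M, is_opair (s 0) (s 1) b /\ is_rank (s 1) b) (fun=> x) d.
- by s1.
- by move=> z /rd [b hb]; exists (pr hM z b), b; split=> //; apply: prP.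
have [f0 hf0] := @sep_S1 M hM (fun M s => exists (z b : M), elt z (s 1) /\
  (is_opair (s 0) z b /\ is_rank z b)) (d .: fun=> x) F ltac:(by s1).
have [||E hE] := @collection_S1 M hM (fun M s => is_rank (s 1) (s 0)) (fun=> x) x.
- by s1.
- by move=> z /= /IH.
have [E1 hE1] := ax_bigcup hM E; have [E2 hE2] := cup_ex hM E1 E.
have [a ha'] := @sep_S1 M hM (fun M s => exists (z e : M), elt z (s 1) /\ (is_rank z e /\
  (elt (s 0) e \/ s 0 = e))) (x .: fun=> x) E2 ltac:(by s1).
have ha c : elt c a <-> exists z e, [/\ elt z x, is_rank z e & elt c e \/ c = e].
  split=> [/ha' /= [_ [z [e [zx [ze ce]]]]]|[z [e [zx ze ce]]]]; first by exists z, e.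
  apply/ha' => /=; split; last by exists z, e.
  apply/hE2; have [e' e'E /= ze'] := hE z zx; rewrite -(is_rank_uniq ze ze') in e'E.
  by case: ce => [ce|->]; [left; apply/hE1; exists e|right].
have [f hf] := adjoin_ex hM f0 (pr hM x a).
(* [f] is the rank function of [d] together with the pair (x, a). *)
have mf z b : maps f z b <-> (elt z d /\ is_rank z b) \/ (z = x /\ b = a).
  split=> [/(mapsE hM) /hf [/hf0 /= [_ [z' [b' [z'd [/(is_opairE hM) e zb]]]]]|]|].
  - by have [-> ->] := pr_inj e; left.
  - by move=> /pr_inj [-> ->]; right.
  move=> [[zd zb]|[-> ->]]; apply/(mapsE hM)/hf; [left|by right].
  apply/hf0; split; last by exists z, b; split=> //; split=> //; apply: prP.
  have [p pF /= [b' [/(is_opairE hM) pe zb']]] := hF z zd.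
  by rewrite (is_rank_uniq zb zb') -pe.
exists a, f, d'; split=> //; first by apply/hd'; right.
- split.
    move=> p /hf [/hf0 /= [_ [z [b [zd [zb _]]]]]|->].
      by exists z, b; split=> //; apply/hd'; left.
    by exists x, a; split; [apply/hd'; right|exact: prP].
  move=> z /hd' [zd|->].
    have [b zb] := rd z zd; exists b; split; first by apply/mf; left.
    move=> b' /mf [[_ zb']|[ex _]]; first exact: is_rank_uniq zb zb'.
    by rewrite ex in zd.
  exists a; split; first by apply/mf; right.
  by move=> b' /mf [[]//|[_ ->]].
- move=> y b /mf [[yd yb]|[-> ->]] c.
    rewrite (is_rank_rec yb); split=> -[z [e [zy ze ce]]]; exists z, e; split=> //.
      by apply/mf; left; split=> //; apply: td yd zy.
    by case/mf: ze => [[]//|[ex _]]; case: nxd; rewrite -ex; apply: td yd zy.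
  rewrite ha; split=> -[z [e [zx ze ce]]]; exists z, e; split=> //.
    by apply/mf; left; split=> //; apply: xd.
  by case/mf: ze => [[]//|[ex _]]; case: nxd; rewrite -ex; apply: xd.
- by apply/mf; right.
Qed.

Definition rk x := projT1 (cid (rank_ex x)).

Lemma rkP x : is_rank x (rk x).
Proof. by rewrite /rk; case: cid. Qed.

Lemma rkE x a : is_rank x a <-> a = rk x.
Proof. by split=> [h|->]; [apply: is_rank_uniq h (rkP x)|apply: rkP]. Qed.

Lemma elt_rkE c x : elt c (rk x) <-> exists2 z, elt z x & elt c (rk z) \/ c = rk z.
Proof.
rewrite (is_rank_rec (rkP x)); split=> [[z [e [zx /rkE -> ce]]]|[z zx ce]]; first by exists z.
by exists z, (rk z); split=> //; apply: rkP.
Qed.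

Lemma rk_elt y x : elt y x -> elt (rk y) (rk x).
Proof. by move=> yx; apply/elt_rkE; exists y => //; right. Qed.

Lemma ordinal_elt a b : ordinal a -> elt b a -> ordinal b.
Proof.
move=> [ta ea] ba; split=> [|c cb]; first exact: ea.
by apply: ea; apply: ta ba cb.
Qed.

Lemma ordinal_rk x : ordinal (rk x).
Proof.
suff : exists a, is_rank x a /\ ordinal a by move=> [a [/rkE ->]].
apply: (@induction_S1 M hM (fun M s => exists a : M, is_rank (s 0) a /\ ordinal a) (fun=> x) _ _ x).
  by s1.
move=> {}x /= IH; exists (rk x); split; first exact: rkP.
have {}IH z : elt z x -> ordinal (rk z) by move=> /IH [a [/rkE ->]].
split=> [y z|y] /elt_rkE [u ux].
  have [tu eu] := IH u ux.
  move=> [yu|->] zy; apply/elt_rkE; exists u => //; left => //; exact: tu yu zy.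
by have [tu eu] := IH u ux; move=> [/eu//|->].
Qed.

Lemma rk_ordinal a : ordinal a -> rk a = a.
Proof.
suff : ~ ordinal a \/ is_rank a a by move=> [//|/rkE].
apply: (@induction_S1 M hM (fun M s => ~ ordinal (s 0) \/ is_rank (s 0) (s 0)) (fun=> a) _ _ a).
  by s1.
move=> {}a /= IH; have [oa|] := EM (ordinal a); [right|by left].
have {}IH b : elt b a -> rk b = b.
  by move=> ba; have [/(_ (ordinal_elt oa ba))|/rkE] := IH b ba.
apply/rkE; apply: (elt_ext hM) => c; rewrite elt_rkE; split.
  by move=> ca; exists c => //; right; rewrite IH.
by move=> [z za]; rewrite IH // => -[cz|->//]; apply: oa.1 za cz.
Qed.

(** Induction on a, and for fixed a on b: if no member of b is a or has a as a member, and
    dually for a, then a and b have the same members. *)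
Lemma ordinal_trichotomy a b : ordinal a -> ordinal b -> [\/ elt a b, a = b | elt b a].
Proof.
pose P a := forall b, ordinal a -> ordinal b -> [\/ elt a b, a = b | elt b a].
suff : P a by apply.
apply: (@induction_separable M hM P) => {a b}.
  apply: (@separable_equiv _ (fun a => ~ exists b, ordinal a /\ (ordinal b /\
      (~ elt a b /\ (a <> b /\ ~ elt b a))))).
    move=> a; split=> [h [b [oa [ob [h1 [h2 h3]]]]]|h b oa ob]; first by case: (h b oa ob).
    apply: contrapT => n; apply: h; exists b; split=> //; split=> //.
    by split; [|split] => ?; apply: n; [constructor 1|constructor 2|constructor 3].
  apply: separable_not => //.
  move=> x; apply: (@separable_S1 M hM (fun M s => exists b : M, ordinal (s 0) /\ (ordinal b /\
      (~ elt (s 0) b /\ (s 0 <> b /\ ~ elt b (s 0))))) (fun=> x)); by s1.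
move=> a IHa b oa; move: b.
suff H b : ~ ordinal b \/ (elt a b \/ (a = b \/ elt b a)).
  by move=> b ob; have [//|[|[]]] := H b; [constructor 1|constructor 2|constructor 3].
apply: (@induction_S1 M hM (fun M s => ~ ordinal (s 0) \/ (elt (s 1) (s 0) \/
   (s 1 = s 0 \/ elt (s 0) (s 1)))) (a .: fun=> a) _ _ b); first by s1.
move=> {}b /= IHb; have [ob|] := EM (ordinal b); [right|by left].
have [[y [yb ay]]|n1] := EM (exists y, elt y b /\ (a = y \/ elt a y)).
  by left; case: ay => [->//|ay]; apply: ob.1 yb ay.
have ba y : elt y b -> elt y a.
  move=> yb; have [/(_ (ordinal_elt ob yb))//|[ay|[ay|//]]] := IHb y yb;
  by case: n1; exists y; split; auto.
have [[x [xa bx]]|n2] := EM (exists x, elt x a /\ (b = x \/ elt b x)).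
  by right; right; case: bx => [->//|bx]; apply: oa.1 xa bx.
right; left; apply: (elt_ext hM) => x; split=> [xa|/ba//].
have [//|xb|bx] := IHa x xa b (ordinal_elt oa xa) ob;
by case: n2; exists x; split; auto.
Qed.

Lemma ordinal_subset a b : ordinal a -> ordinal b -> subset_of a b -> elt a b \/ a = b.
Proof.
move=> oa ob ab; have [|->|/ab/(elt_irrefl hM)//] := ordinal_trichotomy oa ob; first by left.
by right.
Qed.

Lemma ordinal_succ a : ordinal a ->
  exists2 b, ordinal b & forall c, elt c b <-> elt c a \/ c = a.
Proof.
move=> oa; have [b hb] := adjoin_ex hM a a; exists b => //.
split=> [y z /hb [ya|->]|y /hb [ya|->]].
- by move=> zy; apply/hb; left; apply: oa.1 ya zy.
- by move=> za; apply/hb; left.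
- exact: oa.2.
- exact: oa.1.
Qed.

Lemma rk_subset x y : subset_of x y -> elt (rk x) (rk y) \/ rk x = rk y.
Proof.
move=> xy; apply: ordinal_subset; try exact: ordinal_rk.
by move=> c /elt_rkE [z /xy zy ce]; apply/elt_rkE; exists z.
Qed.

Lemma rank_leE x y : rank_le x y <-> elt (rk x) (rk y) \/ rk x = rk y.
Proof.
split=> [[a [b [/rkE -> /rkE ->]]]//|h].
by exists (rk x), (rk y); split=> //; apply: rkP.
Qed.

Lemma rank_belowE a x : rank_below a x <-> elt (rk x) a.
Proof. by split=> [[b /rkE ->]//|h]; exists (rk x) => //; apply: rkP. Qed.

End Rank.

(** * The cumulative hierarchy *)

(** A Sigma_1^P description of the level of the cumulative hierarchy at b: the members of v
    have rank below b, and every subset of v that is missing from v has rank at least b.  By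
    induction this forces every set of rank below b into v. *)
Definition isV (M : structure) (v b : M) :=
  (forall x, elt x v -> exists r, is_rank x r /\ elt r b) /\
  (forall x, subset_of x v -> elt x v \/ exists r, is_rank x r /\ ~ elt r b).

Lemma S1_isV i j : S1 (fun M s => isV (s i) (s j)).
Proof. by rewrite /isV; s1. Qed.
#[export] Hint Resolve S1_isV : s1.

Section CumulativeHierarchy.
Variables (M : structure) (hM : models M KPPS).
Implicit Types (x y z u v a b c : M).

Lemma isVE v b : ordinal b -> isV v b -> forall x, elt x v <-> elt (rk hM x) b.
Proof.
move=> ob [h1 h2] x; split=> [/h1 [r [/(rkE hM) ->]]//|].
suff : elt x v \/ exists r, is_rank x r /\ ~ elt r b.
  by move=> [//|[r [/(rkE hM) -> ]]].
apply: (@induction_S1 M hM (fun M s => elt (s 0) (s 1) \/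
  exists r : M, is_rank (s 0) r /\ ~ elt r (s 2)) (v .: b .: fun=> x) _ _ x); first by s1.
move=> {}x /= IH; have [xb|nxb] := EM (elt (rk hM x) b).
  apply: h2 => y yx; have [//|[r [/(rkE hM) ->]]] := IH y yx.
  by case; apply: ob.1 xb _; apply: rk_elt.
by right; exists (rk hM x); split=> //; apply: rkP.
Qed.

Lemma isV_ex b : ordinal b -> exists v, isV v b.
Proof.
move=> ob; suff [//|//] : ~ ordinal b \/ exists v, isV v b.
apply: (@induction_S1 M hM
  (fun M s => ~ ordinal (s 0) \/ exists v : M, isV v (s 0)) (fun=> b) _ _ b).
  by s1.
move=> {ob}b /= IH; have [ob|] := EM (ordinal b); [right|by left].
have [||Y hY] := @collection_S1 M hM (fun M s => isV (s 0) (s 1)) (fun=> b) b.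
- by s1.
- by move=> c cb /=; have [/(_ (ordinal_elt ob cb))|] := IH c cb.
have [Z hZ] := ax_bigcup hM Y; have [P hP] := ax_pow hM Z.
have [v hv] := @sep_S1 M hM (fun M s => exists r : M, elt r (s 1) /\ is_rank (s 0) r)
  (b .: fun=> b) P ltac:(by s1).
exists v; split=> [x /hv /= [_ [r [rb xr]]]|x xv]; first by exists r.
have [xb|nxb] := EM (elt (rk hM x) b); last by right; exists (rk hM x); split=> //; apply: rkP.
left; apply/hv => /=; split; last by exists (rk hM x); split=> //; apply: rkP.
apply/hP => y yx; apply/hZ; have [w wY /= hw] := hY _ xb.
exists w => //; apply/(isVE (ordinal_rk hM x) hw); exact: rk_elt.
Qed.

Lemma V_ex b : ordinal b -> exists v, forall x, elt x v <-> elt (rk hM x) b.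
Proof. by move=> ob; have [v /(isVE ob) hv] := isV_ex ob; exists v. Qed.

End CumulativeHierarchy.

(** * Embeddings with range closed under elements and subsets *)

(** On such an embedding all quantifiers of Delta_0^P-formulae are absolute.  Rank-initial
    embeddings of models are of this kind, and conversely. *)
Definition initial (M N : structure) (i : M -> N) := [/\ embedding i,
  forall m n, elt n (i m) -> range i n & forall m n, subset_of n (i m) -> range i n].

Section Initial.
Variables (M N : structure) (i : M -> N) (hi : initial i).

Lemma initial_subset x y : subset_of (i x) (i y) <-> subset_of x y.
Proof.
have [[_ ei] ii _] := hi; split=> [xy z /ei /xy /ei//|xy z zx].
by have [w _ wz] := ii _ _ zx; subst z; apply/ei/xy/ei.
Qed.

Lemma initial_Delta0P p : Delta0P p ->
  forall s : nat -> M, sat (i \o s) p <-> sat s p.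
Proof.
have [[inj_i ei] ii si] := hi.
have e x (s : nat -> M) q : sat (i x .: i \o s) q <-> sat (i \o (x .: s)) q.
  by apply: sat_ext => -[].
elim=> {p} /=.
- by [].
- by move=> j k s; rewrite -ei.
- by move=> j k s; split=> [/inj_i|->].
- by move=> p q _ IHp _ IHq s; rewrite IHp IHq.
- by move=> p q _ IHp _ IHq s; rewrite IHp IHq.
- by move=> p q _ IHp _ IHq s; rewrite IHp IHq.
- move=> y p _ IH s; split=> [[x [xy /= hx]]|[x [/= xy hx]]].
    have [z _ zx] := ii _ _ xy; subst x; exists z; split; first exact/ei.
    by apply/IH/e.
  by exists (i x); split; [exact/ei|apply/e/IH].
- move=> y p _ IH s; split=> [h x xy|h x xy]; first by apply/IH/e/h/ei.
  by have [z _ zx] := ii _ _ xy; subst x; apply/e/IH/h/ei.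
- move=> y p _ IH s; split=> [[x [xy hx]]|[x [/= xy hx]]].
    have [z _ zx] := si _ _ xy; subst x; exists z; split; last by apply/IH/e.
    exact/initial_subset.
  by exists (i x); split; [exact/initial_subset|apply/e/IH].
- move=> y p _ IH s; split=> [h x xy|h x xy].
    by apply/IH/e/h; apply/initial_subset.
  have [z _ zx] := si _ _ xy; subst x; apply/e/IH/h.
  exact/initial_subset.
Qed.

(** The structure M is arbitrary here, so this applies to the inclusions of S. *)
Lemma initial_D0 R s : D0 R -> R N (i \o s) <-> R M s.
Proof. by move=> [p hp h]; rewrite !h; exact: initial_Delta0P. Qed.

Lemma initial_S1 R s : models M KPPS -> models N KPPS -> S1 R -> R M s -> R N (i \o s).
Proof.
move=> hM hN [p hp h] /(h _ hM) [x hx]; apply/(h _ hN); exists (i x).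
have : sat (i \o (x .: s)) p by apply/initial_Delta0P.
by apply: iffRL; apply: sat_ext => -[].
Qed.

Lemma initial_is_opair p a b : is_opair (i p) (i a) (i b) <-> is_opair p a b.
Proof. exact: (@initial_D0 _ (p .: a .: b .: fun=> p) (D0_is_opair 0 1 2)). Qed.

End Initial.

Lemma rank_initial_embedding_initial (M N : structure) (i : M -> N) :
  models N KPPS -> rank_initial_embedding i -> initial i.
Proof.
move=> hN [ei ri]; split=> // m n nm; apply: (ri m n); apply/(rank_leE hN).
  by left; apply: rk_elt.
exact: rk_subset.
Qed.

(** The level of the hierarchy at rank(m) is mapped to the level at rank(i m), because its
    description is Sigma_1^P.  An element of rank at most rank(i m) is a subset of it. *)
Lemma initial_rank_initial_embedding (M N : structure) (i : M -> N) :
  models M KPPS -> models N KPPS -> initial i -> rank_initial_embedding i.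
Proof.
move=> hM hN hi; split; first by case: hi.
move=> m n /(rank_leE hN) nm.
have [v hv] := isV_ex hM (ordinal_rk hM m).
have hv' : isV (i v) (i (rk hM m)).
  exact: (@initial_S1 _ _ _ hi _ (v .: rk hM m .: fun=> m) hM hN (S1_isV 0 1) hv).
have rm : is_rank (i m) (i (rk hM m)).
  exact: (@initial_S1 _ _ _ hi _ (m .: rk hM m .: fun=> m) hM hN (S1_is_rank 0 1) (rkP hM m)).
move/(rkE hN) in rm; rewrite rm in hv'.
have [_ _ si] := hi; apply: (si v) => x xn; apply/(isVE hN (ordinal_rk hN (i m)) hv').
have xn' := rk_elt hN xn; case: nm => [nm|<-//].
by apply: (ordinal_rk hN (i m)).1 nm xn'.
Qed.

(** * Rank-cuts and overspill *)

Section RankCut.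
Variables (M S : structure) (j : S -> M) (hM : models M KPPS) (hj : rank_cut j).

Lemma cut_initial : initial j.
Proof. exact: rank_initial_embedding_initial hM hj.1. Qed.

Lemma cut_le x y : range j y -> elt (rk hM x) (rk hM y) \/ rk hM x = rk hM y -> range j x.
Proof. by move=> [s _ <-] h; apply: (hj.1.2 s); apply/(rank_leE hM). Qed.

Lemma cut_elt x y : range j y -> elt x y -> range j x.
Proof. by move=> ry xy; apply: cut_le ry _; left; apply: rk_elt. Qed.

Lemma cut_subset x y : range j y -> subset_of x y -> range j x.
Proof. by move=> ry xy; apply: cut_le ry _; exact: rk_subset. Qed.

Lemma cut_rk y : range j y -> range j (rk hM y).
Proof. by move=> ry; apply: cut_le ry _; right; rewrite rk_ordinal //; exact: ordinal_rk. Qed.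

Lemma cut_bound : exists2 a, ordinal a & forall s, elt (rk hM (j s)) a.
Proof.
have [[a oa ha] _] := hj.2; exists a => // s; apply/(rank_belowE hM)/ha.
by exists s.
Qed.

(** Otherwise the successor of a would be the least ordinal outside the cut. *)
Lemma cut_succ a b : ordinal a -> range j a ->
  (forall c, elt c b <-> elt c a \/ c = a) -> range j b.
Proof.
move=> oa ra hb; apply: contrapT => nrb.
have [b' ob' hb'] := ordinal_succ hM oa.
have eb : b = b' by apply: (elt_ext hM) => c; rewrite hb hb'.
have [c [oc nrc]] : exists b'0, [/\ ordinal b'0, ~ range j b'0 & elt b'0 b].
  by apply: hj.2.2 => //; rewrite eb.
by move=> /hb [ca|e]; apply: nrc; [apply: cut_elt ra ca|rewrite e].
Qed.

(** The rank of a pair is at most one more than the larger of the two ranks. *)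
Lemma cut_upair p a b : range j a -> range j b -> is_upair p a b -> range j p.
Proof.
wlog ab : a b / elt (rk hM a) (rk hM b) \/ rk hM a = rk hM b.
  move=> H ra rb hp; have [ab|ab|ba] := ordinal_trichotomy hM (ordinal_rk hM a) (ordinal_rk hM b).
  - by apply: H ra rb hp; left.
  - by apply: H ra rb hp; right.
  - by apply: (H b a _ rb ra); [left|move=> z; rewrite hp; tauto].
move=> ra rb hp; have ob := ordinal_rk hM b.
have [c oc hc] := ordinal_succ hM ob.
have rc : range j c by apply: cut_succ ob (cut_rk rb) hc.
apply: (cut_le rc); rewrite (rk_ordinal hM oc).
apply: (ordinal_subset hM) => //; first exact: ordinal_rk.
move=> x /(elt_rkE hM) [z /hp zp] xz; apply/hc.
have [zb|zb] : elt (rk hM z) (rk hM b) \/ rk hM z = rk hM b by case: zp => ->; auto.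
  by left; case: xz => [xz|->//]; apply: ob.1 zb xz.
by rewrite -zb; tauto.
Qed.

Lemma cut_opair_ex (a b : S) : exists p : S, is_opair p a b.
Proof.
have ra : range j (j a) by exists a.
have rb : range j (j b) by exists b.
have [c [d [hc hd hp]]] := prP hM (j a) (j b).
have [p _ ep] : range j (pr hM (j a) (j b)).
  exact: cut_upair (cut_upair ra ra hc) (cut_upair ra rb hd) hp.
exists p; apply/(initial_is_opair cut_initial); rewrite ep; exact: prP.
Qed.

Lemma cut_singleton_ex (a : S) : exists b : S, forall z, elt z b <-> z = a.
Proof.
have [p hp] := ax_upair hM (j a) (j a).
have [b _ eb] : range j p by apply: cut_upair hp; exists a.
have [[inj_j ej] _ _] := cut_initial.
exists b => z; rewrite ej eb hp; split=> [[] /inj_j//|->]; by left.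
Qed.

Lemma cut_point : exists s : S, True.
Proof.
apply: contrapT => n.
have nr x : ~ range j x by move=> [s _ _]; apply: n; exists s.
have [[a oa _] top] := hj.2.
suff : ~ ordinal a by [].
apply: (@induction_S1 M hM (fun M s => ~ ordinal (s 0)) (fun=> a) _ _ a); first by s1.
move=> x /= IH ox; have [b [ob _ bx]] := top x ox (nr x).
exact: IH bx ob.
Qed.

Lemma cut_empty_ex : exists e : S, forall z, ~ elt z e.
Proof.
have [s _] := cut_point; have [e he] := empty_ex hM (j s).
have [e' _ ee] : range j e by apply: (@cut_subset _ (j s)); [exists s|move=> z /he].
have [[_ ej] _ _] := cut_initial.
by exists e' => z /ej; rewrite ee => /he.
Qed.

(** The intersection of v with a coded class is a subset of v.  This is what puts the
    approximations A ∩ v of a coded class A of codes into S. *)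
Lemma cut_comprehension (A : set S) (v : S) : Cod j A ->
  exists b : S, forall x, elt x b <-> elt x v /\ A x.
Proof.
move=> [c _ <-]; have [p hp] := @sep_S1 M hM (fun M s => elt (s 0) (s 1))
  (c .: fun=> c) (j v) ltac:(by s1).
have [[_ ej] _ _] := cut_initial.
have [b _ eb] : range j p by apply: (@cut_subset _ (j v)); [exists v|move=> z /hp []].
by exists b => x; rewrite ej eb hp /= -ej.
Qed.

Lemma cut_superset : exists v, forall s, elt (j s) v.
Proof.
have [a oa ha] := cut_bound; have [v hv] := V_ex hM oa.
by exists v => s; apply/hv.
Qed.

Lemma Cod_separable (P : M -> Prop) : separable P -> Cod j [set s | P (j s)].
Proof.
move=> hP; have [v hv] := cut_superset; have [c hc] := hP v.
by exists c => //; apply/seteqP; split=> s /=; rewrite hc; have := hv s; tauto.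
Qed.

(** If P held at no ordinal outside the cut, then Separation would turn the ordinals of the
    cut into a set, hence into an ordinal, which would be the least one outside the cut. *)
Lemma overspill (P : M -> Prop) : separable P ->
  (forall b, ordinal b -> range j b -> P b) ->
  exists b, [/\ ordinal b, P b & forall s, elt (rk hM (j s)) b].
Proof.
move=> sP hP; have [a oa ha] := cut_bound; have [o ho] := sP a.
have [[b [ob nrb Pb]]|n] := EM (exists b, [/\ ordinal b, ~ range j b & P b]).
  exists b; split=> // s; have os := ordinal_rk hM (j s).
  have rs : range j (rk hM (j s)) by apply: cut_rk; exists s.
  have [//|e|bs] := ordinal_trichotomy hM os ob; case: nrb; first by rewrite -e.
  exact: cut_elt rs bs.
have ro u : elt u o -> range j u.
  move=> /ho [ua Pu]; apply: contrapT => nru; apply: n; exists u; split=> //.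
  exact: ordinal_elt oa ua.
have ou u : elt u o -> ordinal u by move=> /ho [ua _]; apply: ordinal_elt oa ua.
have oo : ordinal o.
  split=> [y z yo zy|y /ou []//]; apply/ho; split.
    by apply: oa.1 zy; have [] := iffLR (ho y) yo.
  by apply: hP; [apply: ordinal_elt (ou y yo) zy|apply: cut_elt (ro y yo) zy].
have nro : ~ range j o.
  move=> ro'; case: (elt_irrefl hM (x := o)); apply/ho; split; last exact: hP.
  by case: ro' => s _ e; have := ha s; rewrite e rk_ordinal.
have [b [_ nrb bo]] := hj.2.2 o oo nro.
by case: nrb; apply: ro.
Qed.

End RankCut.

(** * Codes and supports *)

Fixpoint is_num (M : structure) (n : nat) (x : M) : Prop :=
  if n is m.+1 then exists y, elt y x /\ (is_num m y /\ forall z, elt z x -> z = y)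
  else forall z, elt z x -> False.

(** g = f ∪ {(j, v)}. *)
Definition is_ext (M : structure) (f j v g : M) :=
  forall z, elt z g <-> elt z f \/ is_opair z j v.

Inductive kind := ExCode | SubCode | MemCode | NmemCode | EqCode | ConstCode.

Definition code_tag (k : kind) : nat :=
  match k with
  | ExCode => 0 | SubCode => 1 | MemCode => 2 | NmemCode => 3 | EqCode => 4 | ConstCode => 5
  end.

(** t = (kd, (j, (k, a))), where the kind is represented by a numeral. *)
Definition is_code (M : structure) (kd : kind) (t j k a : M) :=
  exists c p q, is_num (code_tag kd) c /\ (is_opair t c p /\ (is_opair p j q /\ is_opair q k a)).

(** What justifies a pair (code, f) in the support w, relative to the family F of supports.
    For [ExCode] the extended tuples must be in a support w' that is linked to w by an entry
    (0, w'), hence of smaller rank than w; this is the source of the descending ranks that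
    make the embedding topless.  For [SubCode] they stay in w. *)
Definition content (M : structure) (kd : kind) (F w f j k a : M) : Prop :=
  match kd with
  | ExCode => exists w', elt w' F /\ ((exists e, is_num 0 e /\ maps w e w') /\
      exists v g, is_ext f j v g /\ forall t, elt t a -> maps w' t g)
  | SubCode => exists x, maps f k x /\ forall v, subset_of v x ->
      exists t g, elt t a /\ (is_ext f j v g /\ maps w t g)
  | MemCode => exists x y, maps f j x /\ (maps f k y /\ elt x y)
  | NmemCode => exists x y, maps f j x /\ (maps f k y /\ ~ elt x y)
  | EqCode => exists x, maps f j x /\ maps f k x
  | ConstCode => maps f j k
  end.

(** The empty set is not a code, so entries with first component 0 can serve as links. *)
Definition clause (M : structure) (F w t f : M) :=
  is_num 0 t \/ exists j k a,
    let C kd := is_code kd t j k a /\ content kd F w f j k a in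
    C ExCode \/ (C SubCode \/ (C MemCode \/ (C NmemCode \/ (C EqCode \/ C ConstCode)))).

Definition good (M : structure) (F : M) :=
  forall w, elt w F -> forall t f, maps w t f -> clause F w t f.

(** Truth with a bound on the support, by which the ranks of supports are compared with an
    ordinal. *)
Definition SatIn (M : structure) (e p : M) :=
  exists F w, good F /\ (elt w F /\ (elt p w /\ subset_of w e)).

Definition Sat (M : structure) (p : M) := exists F w, good F /\ (elt w F /\ elt p w).

Lemma D0_is_num n i : D0 (fun M s => is_num n (s i)).
Proof.
elim: n i => [|n IH] i /=; first by d0.
by d0; exact: (IH 0).
Qed.
#[export] Hint Resolve D0_is_num : d0.

Lemma S1_is_ext i j k l : S1 (fun M s => is_ext (s i) (s j) (s k) (s l)).
Proof.
apply: (@S1_equiv (fun M s =>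
    (forall z : M, elt z (s l) -> elt z (s i) \/ is_opair z (s j) (s k)) /\
  ((forall z : M, elt z (s i) -> elt z (s l)) /\ maps (s l) (s j) (s k)))); last by s1.
move=> M hM s; split=> [h|[h1 [h2 h3]] z].
  split=> [z /h//|]; split=> [z zi|]; first by apply/h; left.
  by apply/(mapsE hM)/h; right; apply: prP.
split=> [/h1//|[/h2//|/(is_opairE hM) ->]]; exact/(mapsE hM).
Qed.
#[export] Hint Resolve S1_is_ext : s1.

Lemma S1_is_code kd i j k l : S1 (fun M s => is_code kd (s i) (s j) (s k) (s l)).
Proof. by rewrite /is_code; s1. Qed.
#[export] Hint Resolve S1_is_code : s1.

Lemma S1_content kd i1 i2 i3 i4 i5 i6 :
  S1 (fun M s => content kd (s i1) (s i2) (s i3) (s i4) (s i5) (s i6)).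
Proof. by case: kd; s1. Qed.
#[export] Hint Resolve S1_content : s1.

Lemma S1_clause i j k l : S1 (fun M s => clause (s i) (s j) (s k) (s l)).
Proof. by rewrite /clause; s1. Qed.
#[export] Hint Resolve S1_clause : s1.

Lemma S1_good i : S1 (fun M s => good (s i)).
Proof. by rewrite /good; s1. Qed.
#[export] Hint Resolve S1_good : s1.

Lemma S1_SatIn i j : S1 (fun M s => SatIn (s i) (s j)).
Proof. by rewrite /SatIn; s1. Qed.
Lemma S1_Sat i : S1 (fun M s => Sat (s i)).
Proof. by rewrite /Sat; s1. Qed.
#[export] Hint Resolve S1_SatIn S1_Sat : s1.

Section Codes.
Variables (M : structure) (hM : models M KPPS).
Implicit Types (F w f g j k a p q t x y z v : M) (kd : kind).

Lemma is_num_inj m n x : is_num m x -> is_num n x -> m = n.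
Proof.
elim: m n x => [|m IH] [|n] x //=; first by move=> h [y [/h]].
  by move=> [y [yx _]] /(_ y yx).
move=> [y [yx [my hy]]] [z [zx [nz hz]]]; congr _.+1.
by apply: IH my _; rewrite (hz _ yx).
Qed.

Lemma code_tag_inj : injective code_tag.
Proof. by case; case. Qed.

Lemma is_code_inj kd kd' t j k a j' k' a' : is_code kd t j k a -> is_code kd' t j' k' a' ->
  [/\ kd = kd', j = j', k = k' & a = a'].
Proof.
move=> [c [p [q [hc [/(is_opairE hM) -> [/(is_opairE hM) -> /(is_opairE hM) ->]]]]]].
move=> [c' [p' [q' [hc' [/(is_opairE hM) e1 [/(is_opairE hM) e2 /(is_opairE hM) e3]]]]]].
subst p' q'; case/pr_inj: e1 => ec /pr_inj [-> /pr_inj [-> ->]]; subst c'.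
by rewrite (code_tag_inj (is_num_inj hc hc')).
Qed.

Lemma is_code_nonempty kd t j k a : is_code kd t j k a -> ~ is_num 0 t.
Proof. by move=> [c [p [q [_ [/opair_bounded [d [_ [dt _ _ _]]] _]]]]] /(_ d dt). Qed.

(** The definition lists the six kinds explicitly so as to be visibly a formula. *)
Lemma clauseP F w t f : clause F w t f <->
  is_num 0 t \/ exists kd j k a, is_code kd t j k a /\ content kd F w f j k a.
Proof.
split=> -[nt|]; try by left.
  move=> [j [k [a h]]]; right; move: h => /=.
  by case=> [|[|[|[|[]]]]] h; [exists ExCode|exists SubCode|exists MemCode|exists NmemCode|
    exists EqCode|exists ConstCode]; exists j, k, a.
by move=> [kd [j [k [a h]]]]; right; exists j, k, a; case: kd h => /=; tauto.
Qed.

Lemma clause_content F w t f kd j k a :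
  clause F w t f -> is_code kd t j k a -> content kd F w f j k a.
Proof.
move=> /clauseP [nt|[kd' [j' [k' [a' [ht' h]]]]]] ht; first by case: (is_code_nonempty ht).
by have [<- <- <- <-] := is_code_inj ht' ht.
Qed.

Lemma maps_mono w w' x y : subset_of w w' -> maps w x y -> maps w' x y.
Proof. by move=> ww [p hp /ww pw]; exists p. Qed.

Lemma content_mono kd F F' w w' f j k a : subset_of F F' -> subset_of w w' ->
  content kd F w f j k a -> content kd F' w' f j k a.
Proof.
move=> FF ww; case: kd => //=.
  move=> [w0 [/FF w0F [[e [he /(maps_mono ww) ewv]] [v [g [hg h]]]]]].
  by exists w0; split=> //; split; [exists e|exists v, g].
move=> [x [xf h]]; exists x; split=> // v /h [t [g [ta [hg /(maps_mono ww) tg]]]].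
by exists t, g.
Qed.

Lemma clause_mono F F' w w' t f : subset_of F F' -> subset_of w w' ->
  clause F w t f -> clause F' w' t f.
Proof.
move=> FF ww /clauseP h; apply/clauseP; case: h => [|[kd [j [k [a [h1 h2]]]]]]; first by left.
by right; exists kd, j, k, a; split=> //; apply: content_mono h2.
Qed.

Lemma ext_ex f j v : exists g, is_ext f j v g.
Proof. by have [g hg] := adjoin_ex hM f (pr hM j v); exists g => z; rewrite hg (is_opairE hM). Qed.

Definition ext f j v := projT1 (cid (ext_ex f j v)).

Lemma extP f j v : is_ext f j v (ext f j v).
Proof. by rewrite /ext; case: cid. Qed.

Lemma is_extE f j v g : is_ext f j v g <-> g = ext f j v.
Proof.
split=> [h|->]; last exact: extP.
by apply: (elt_ext hM) => z; rewrite (h z) (extP f j v z).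
Qed.

Lemma maps_ext f j v k x : maps (ext f j v) k x <-> maps f k x \/ (k = j /\ x = v).
Proof.
rewrite !(mapsE hM) (extP f j v) (is_opairE hM).
by split=> -[h|h]; [left|right; exact: pr_inj h|left|right; case: h => -> ->].
Qed.

(** Justifications are positive, so they are preserved when the family grows and when
    supports are united. *)
Lemma collect_SatIn e (D : M) : (forall p, elt p D -> SatIn e p) ->
  exists F w, [/\ good F, elt w F, subset_of D w & subset_of w e].
Proof.
move=> hD.
have [||Y hY] := @collection_S1 M hM (fun M s => good (s 0) /\ exists w : M, elt w (s 0) /\
   (elt (s 1) w /\ subset_of w (s 2))) (e .: fun=> e) D.
- by s1.
- by move=> p /hD [F [w [gF h]]]; exists F; split=> //; exists w.
have [Z hZ] := @sep_S1 M hM (fun M s => good (s 0)) (fun=> e) Y ltac:(by s1).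
have [F0 hF0] := ax_bigcup hM Z.
have [W hW] := @sep_S1 M hM (fun M s => subset_of (s 0) (s 1)) (e .: fun=> e) F0 ltac:(by s1).
have [w hw] := ax_bigcup hM W; have [F hF] := adjoin_ex hM F0 w.
have cF v t f : elt v F0 -> maps v t f -> clause F v t f.
  move=> /hF0 [F1 /hZ [F1Y gF1] vF1] vtf; apply: clause_mono (gF1 v vF1 t f vtf) => // u uF1.
  by apply/hF; left; apply/hF0; exists F1 => //; apply/hZ.
exists F, w; split.
- move=> v /hF [vF0|->] t f; first exact: cF.
  move=> [p hp /hw [u /hW [uF0 ue] pu]]; apply: (@clause_mono F F u) => //.
    by move=> z zu; apply/hw; exists u => //; apply/hW.
  by apply: cF uF0 _; exists p.
- by apply/hF; right.
- move=> p /hY [F1 F1Y /= [gF1 [v [vF1 [pv ve]]]]]; apply/hw; exists v => //.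
  by apply/hW; split=> //; apply/hF0; exists F1 => //; apply/hZ.
- by move=> p /hw [u /hW [_ /= ue]] /ue.
Qed.

Lemma collect_Sat (D : M) : (forall p, elt p D -> Sat p) ->
  exists F w, [/\ good F, elt w F & subset_of D w].
Proof.
move=> hD.
have [||Y hY] := @collection_S1 M hM (fun M s => SatIn (s 0) (s 1)) (fun=> D) D.
- by s1.
- by move=> p /hD [F [w [gF [wF pw]]]]; exists w, F, w; do 3 split=> //.
have [e he] := ax_bigcup hM Y.
have [|F [w [gF wF Dw _]]] := @collect_SatIn e D; last by exists F, w.
move=> p /hY [e' e'Y /= [F [w [gF [wF [pw we]]]]]]; exists F, w; do 3 split=> //.
by move=> z /we ze; apply/he; exists e'.
Qed.

Lemma add_entry F w t f : good F -> (forall t f, maps w t f -> clause F w t f) ->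
  clause F w t f ->
  exists F' w', [/\ good F', elt w' F', subset_of F F' & maps w' t f].
Proof.
move=> gF gw htf.
have [w' hw'] := adjoin_ex hM w (pr hM t f); have [F' hF'] := adjoin_ex hM F w'.
have FF : subset_of F F' by move=> z zF; apply/hF'; left.
have ww : subset_of w w' by move=> z zw; apply/hw'; left.
exists F', w'; split=> //; last by apply/(mapsE hM)/hw'; right.
  move=> v /hF' [vF|->] t' f' h; first exact: clause_mono (gF v vF t' f' h).
  move: h => /(mapsE hM)/hw' [/(mapsE hM) h|/pr_inj [-> ->]]; last exact: clause_mono htf.
  exact: clause_mono (gw _ _ h).
by apply/hF'; right.
Qed.

Lemma Sat_clause F w t f : good F -> elt w F -> clause F w t f -> Sat (pr hM t f).
Proof.
move=> gF wF /(add_entry gF (gF w wF)) [F' [w' [gF' w'F' _ /(mapsE hM) h]]].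
by exists F', w'.
Qed.

Lemma add_link F w : good F -> elt w F ->
  exists F' w' e, [/\ good F', elt w' F', subset_of F F' & is_num 0 e /\ maps w' e w].
Proof.
move=> gF wF; have [e he] := empty_ex hM F.
have [||F' [w' [gF' w'F' FF ew]]] := @add_entry F e e w gF; last by exists F', w', e.
  by move=> t f [p _ /he].
by left.
Qed.

Lemma image_ex (R : predicate) s x : S1 R ->
  (forall u, elt u x -> exists v, R M (v .: u .: s) /\ Sat v) ->
  exists D, (forall p, elt p D -> Sat p) /\
    (forall u, elt u x -> exists v, R M (v .: u .: s) /\ elt v D).
Proof.
move=> hR h.
have [||Y hY] := @collection_S1 M hM (fun M s => R M s /\ Sat (s 0)) s x.
- by apply: S1_and => //; s1.
- exact: h.
have [D hD] := @sep_S1 M hM (fun M s => Sat (s 0)) s Y ltac:(by s1).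
exists D; split=> [p /hD []//|u /hY [v vY [hv Sv]]].
by exists v; split=> //; apply/hD.
Qed.

(** The supports of the extended tuples are united to one support, and a new one is linked to
    it. *)
Lemma Sat_Ex t f j k a v : is_code ExCode t j k a ->
  (forall t', elt t' a -> Sat (pr hM t' (ext f j v))) -> Sat (pr hM t f).
Proof.
move=> ht h.
have [||D [hD1 hD2]] := @image_ex (fun M s => is_opair (s 0) (s 1) (s 2))
  (ext f j v .: fun=> f) a.
- by s1.
- move=> u ua /=; exists (pr hM u (ext f j v)); split; [exact: prP|exact: h].
have [F [w [gF wF Dw]]] := collect_Sat hD1.
have [F' [w' [e [gF' w'F' FF ew]]]] := add_link gF wF.
apply: (Sat_clause gF' w'F'); apply/clauseP; right; exists ExCode, j, k, a; split=> //=.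
exists w; split; first exact: FF.
split; first by exists e.
exists v, (ext f j v); split; first exact: extP.
by move=> t' /hD2 [p [hp pD]]; exists p => //; apply: Dw.
Qed.

Lemma Sat_Sub t f j k a x : is_code SubCode t j k a -> maps f k x ->
  (forall v, subset_of v x -> exists2 t', elt t' a & Sat (pr hM t' (ext f j v))) ->
  Sat (pr hM t f).
Proof.
move=> ht hx h; have [P hP] := ax_pow hM x.
have [||D [hD1 hD2]] := @image_ex (fun M s => exists (t g : M), elt t (s 4) /\
  (is_ext (s 2) (s 3) (s 1) g /\ is_opair (s 0) t g)) (f .: j .: a .: fun=> f) P.
- by s1.
- move=> v /hP /h [t' ta hS]; exists (pr hM t' (ext f j v)); split=> //=.
  by exists t', (ext f j v); split=> //; split; [exact: extP|exact: prP].
have [F [w [gF wF Dw]]] := collect_Sat hD1.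
apply: (Sat_clause gF wF); apply/clauseP; right; exists SubCode, j, k, a; split=> //=.
exists x; split=> // v /hP /hD2 [p [/= [t' [g [ta [hg hp]]]] pD]].
by exists t', g; split=> //; split=> //; exists p => //; apply: Dw.
Qed.

Lemma Sat_atom t f kd j k a : is_code kd t j k a -> content kd f f f j k a ->
  kd <> ExCode -> kd <> SubCode -> Sat (pr hM t f).
Proof.
move=> ht hc nEx nSub; have [e he] := empty_ex hM f.
have ge : good e by move=> w /he.
have [||F' [w' [gF' w'F' FF /(mapsE hM) ew]]] := @add_entry e e t f ge; last by exists F', w'.
  by move=> t' f' [p _ /he].
by apply/clauseP; right; exists kd, j, k, a; split=> //; case: kd ht hc nEx nSub.
Qed.

Lemma SatE t f F w kd j k a : good F -> elt w F -> maps w t f ->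
  is_code kd t j k a -> content kd F w f j k a.
Proof. by move=> gF wF /(gF w wF) h ht; apply: clause_content h ht. Qed.

End Codes.

(** * Tuples *)

(** Tuples grow at the head of the list, so positions are counted from the end; they do not
    change when the list grows. *)
Fixpoint has_at (T : Type) (l : seq T) (i : nat) (x : T) : Prop :=
  if l is y :: l' then (i = size l' /\ x = y) \/ has_at l' i x else False.

Lemma has_at_lt T (l : seq T) i x : has_at l i x -> i < size l.
Proof. by elim: l => [//|y l IH] /= [[-> _]|/IH /ltnW]. Qed.

Lemma has_at_uniq T (l : seq T) i x x' : has_at l i x -> has_at l i x' -> x = x'.
Proof.
elim: l => [//|y l IH] /= [[ei ->]|h] [[ei' ->]|h'] //; last exact: IH.
  by have := has_at_lt h'; rewrite ei ltnn.
by have := has_at_lt h; rewrite ei' ltnn.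
Qed.

Lemma has_at_map T U (f : T -> U) l i y :
  has_at (map f l) i y <-> exists2 x, has_at l i x & y = f x.
Proof.
elim: l => [|z l IH] /=; first by split=> [|[]].
rewrite size_map IH; split=> [[[-> ->]|[x hx ->]]|[x [[-> ->]|hx] ->]].
- by exists z => //; left.
- by exists x => //; right.
- by left.
- by right; exists x.
Qed.

Section Cut.
Variables (M S : structure) (j : S -> M) (hM : models M KPPS) (hj : rank_cut j).

Lemma initial_is_code (N : structure) (i : S -> N) kd t k l a : initial i ->
  is_code kd t k l a -> is_code kd (i t) (i k) (i l) (i a).
Proof.
move=> hi [c [p [q [hc [h1 [h2 h3]]]]]]; exists (i c), (i p), (i q); split.
  exact: (iffRL (@initial_D0 _ _ _ hi _ (fun=> c) (D0_is_num (code_tag kd) 0)) hc).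
by split; [|split]; apply/(initial_is_opair hi).
Qed.

(** Numerals serve both as tags of codes and as indices of tuples. *)
Lemma cut_num_ex n : exists x : S, is_num n x.
Proof.
elim: n => [|n [x hx]]; first exact: cut_empty_ex hM hj.
have [y hy] := cut_singleton_ex hM hj x.
by exists y, x; split; [apply/hy|split=> // z /hy].
Qed.

Lemma cut_code_ex kd (k l a : S) : exists t, is_code kd t k l a.
Proof.
have [c hc] := cut_num_ex (code_tag kd); have [q hq] := cut_opair_ex hM hj l a.
have [p hp] := cut_opair_ex hM hj k q; have [t ht] := cut_opair_ex hM hj c p.
by exists t, c, p, q.
Qed.

(** A level of the hierarchy at b has rank at most b. *)
Lemma cut_V v b : ordinal b -> range j b -> isV v b -> range j v.
Proof.
move=> ob rb hv; apply: (cut_le (hM := hM) hj rb); rewrite (rk_ordinal hM ob).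
apply: (ordinal_subset hM) (ob) _; first exact: ordinal_rk.
move=> c /(elt_rkE hM) [z /(isVE hM ob hv) zb] [cz|->//]; exact: ob.1 zb cz.
Qed.

Variable key : nat -> S.

(** The list as an element of the model: the function that maps the numeral of a position to
    the entry there. *)
Fixpoint tup (l : seq M) : M :=
  if l is x :: l' then ext hM (tup l') (j (key (size l'))) x else j (key 0).

Hypothesis key_num : forall n, is_num n (key n).

Lemma key_inj m n : j (key m) = j (key n) -> m = n.
Proof.
have [[inj_j _] _ _] := cut_initial hM hj.
move=> /inj_j e; have H k : is_num k (j (key k)).
  exact: (iffRL (@initial_D0 _ _ _ (cut_initial hM hj) _ (fun=> key k) (D0_is_num k 0))
    (key_num k)).
by apply: (is_num_inj (H m)); rewrite e.
Qed.

Lemma maps_tup l i x : maps (tup l) (j (key i)) x <-> has_at l i x.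
Proof.
elim: l => [|y l IH] /=.
  split=> // -[p _ hp]; have [_ ii _] := cut_initial hM hj.
  have [q _ eq] := ii _ _ hp; subst p.
  have [[_ ej] _ _] := cut_initial hM hj.
  by move/ej: hp; apply: (key_num 0).
rewrite maps_ext IH; split=> [[h|[/key_inj -> ->]]|[[-> ->]|h]]; by [left|right].
Qed.

End Cut.

Lemma maps_rk (M : structure) (hM : models M KPPS) (f x y : M) : maps f x y ->
  elt (rk hM x) (rk hM f) /\ elt (rk hM y) (rk hM f).
Proof.
move=> [p /opair_bounded [c [d [cp dp xc yd]]] pf].
have tr a b e : elt (rk hM a) (rk hM b) -> elt (rk hM b) (rk hM e) -> elt (rk hM a) (rk hM e).
  by move=> ab be; apply: (ordinal_rk hM e).1 be ab.
have pf' := rk_elt hM pf.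
split; [apply: (tr _ p) pf'; apply: (tr _ c)|apply: (tr _ p) pf'; apply: (tr _ d)];
  exact: rk_elt.
Qed.

Section BackAndForth.
Variables (M N S : structure) (jM : S -> M) (jN : S -> N).
Variables (hM : models M KPPS) (hN : models N KPPS).
Variables (cutM : rank_cut jM) (cutN : rank_cut jN).
Hypothesis eqCod : Cod jM = Cod jN.

Definition key n := projT1 (cid (cut_num_ex hM cutM n)).

Lemma keyP n : is_num n (key n).
Proof. by rewrite /key; case: cid. Qed.

Definition TM (l : seq (M * N)) := tup jM hM key (map fst l).
Definition TN (l : seq (M * N)) := tup jN hN key (map snd l).

Lemma TM_cons m n l : TM ((m, n) :: l) = ext hM (TM l) (jM (key (size l))) m.
Proof. by rewrite /TM /= size_map. Qed.

Lemma TN_cons m n l : TN ((m, n) :: l) = ext hN (TN l) (jN (key (size l))) n.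
Proof. by rewrite /TN /= size_map. Qed.

Lemma maps_TM l i x : maps (TM l) (jM (key i)) x <-> exists n, has_at l i (x, n).
Proof.
rewrite (maps_tup hM cutM keyP) has_at_map.
by split=> [[[m n] h /= ->]|[n h]]; [exists n|exists (x, n)].
Qed.

Lemma maps_TN l i x : maps (TN l) (jN (key i)) x <-> exists m, has_at l i (m, x).
Proof.
rewrite (maps_tup hN cutN keyP) has_at_map.
by split=> [[[m n] h /= ->]|[n h]]; [exists m|exists (n, x)].
Qed.

Lemma TN_at l i m n x : has_at l i (m, n) -> maps (TN l) (jN (key i)) x -> x = n.
Proof. by move=> h /maps_TN [m' /(has_at_uniq h) []]. Qed.

(** * Back and forth *)

(** The support [sup] lies in N only; the family [fam] is what justifies it. *)
Record condition := Condition { pairs : seq (M * N); fam : N; sup : N }.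

(** Only codes from S are compared, since these are the ones that both models have. *)
Definition valid (c : condition) := [/\ good (fam c), elt (sup c) (fam c) &
  forall t : S, Sat (pr hM (jM t) (TM (pairs c))) -> maps (sup c) (jN t) (TN (pairs c))].

Definition codeS kd (k l a : S) := projT1 (cid (cut_code_ex hM cutM kd k l a)).

Lemma codeSP kd k l a : is_code kd (codeS kd k l a) k l a.
Proof. by rewrite /codeS; case: cid. Qed.

Lemma codeM kd k l a : is_code kd (jM (codeS kd k l a)) (jM k) (jM l) (jM a).
Proof. by apply: initial_is_code (codeSP _ _ _ _); exact: cut_initial hM cutM. Qed.

Lemma codeN kd k l a : is_code kd (jN (codeS kd k l a)) (jN k) (jN l) (jN a).
Proof. by apply: initial_is_code (codeSP _ _ _ _); exact: cut_initial hN cutN. Qed.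

Lemma valid_content c kd k l a : valid c ->
  Sat (pr hM (jM (codeS kd k l a)) (TM (pairs c))) ->
  content kd (fam c) (sup c) (TN (pairs c)) (jN k) (jN l) (jN a).
Proof. by move=> [gF wF h] /h hw; apply: SatE gF wF hw (codeN _ _ _ _). Qed.

Lemma valid_atom c kd k l a : valid c -> kd <> ExCode -> kd <> SubCode ->
  content kd (TM (pairs c)) (TM (pairs c)) (TM (pairs c)) (jM k) (jM l) (jM a) ->
  content kd (fam c) (sup c) (TN (pairs c)) (jN k) (jN l) (jN a).
Proof.
move=> vc nEx nSub h; apply: valid_content vc _.
exact: Sat_atom (codeM _ _ _ _) h nEx nSub.
Qed.

Section Atoms.
Variables (c : condition) (vc : valid c).
Variables (a b : nat) (m m' : M) (n n' : N).
Hypotheses (ha : has_at (pairs c) a (m, n)) (hb : has_at (pairs c) b (m', n')).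

Let ma : maps (TM (pairs c)) (jM (key a)) m. Proof. by apply/maps_TM; exists n. Qed.
Let mb : maps (TM (pairs c)) (jM (key b)) m'. Proof. by apply/maps_TM; exists n'. Qed.

Lemma valid_eq : m = m' -> n = n'.
Proof.
move=> e; have [|||x [/(TN_at ha) -> /(TN_at hb) //]] :=
  @valid_atom c EqCode (key a) (key b) (key 0) vc.
- by [].
- by [].
- by exists m; split=> //; rewrite e.
Qed.

Lemma valid_mem : elt m m' -> elt n n'.
Proof.
move=> e; have [|||x [y [/(TN_at ha) -> [/(TN_at hb) -> //]]]] :=
  @valid_atom c MemCode (key a) (key b) (key 0) vc.
- by [].
- by [].
- by exists m, m'.
Qed.

Lemma valid_nmem : ~ elt m m' -> ~ elt n n'.
Proof.
move=> e; have [|||x [y [/(TN_at ha) -> [/(TN_at hb) -> //]]]] :=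
  @valid_atom c NmemCode (key a) (key b) (key 0) vc.
- by [].
- by [].
- by exists m, m'.
Qed.

Lemma valid_const s : m = jM s -> n = jN s.
Proof.
move=> e; have H : maps (TN (pairs c)) (jN (key a)) (jN s).
  by apply: (@valid_atom c ConstCode (key a) s (key 0) vc) => //=; rewrite -e.
by rewrite (TN_at ha H).
Qed.

(** A tuple in a support has smaller rank than the support, and some code is true of it. *)
Lemma valid_rk : elt (rk hN n) (rk hN (sup c)).
Proof.
have [gF wF h] := vc.
have hw : maps (sup c) (jN (codeS EqCode (key a) (key a) (key 0))) (TN (pairs c)).
  by apply: h; apply: Sat_atom (codeM _ _ _ _) _ _ _ => //; exists m.
have [_ h1] := maps_rk hN hw.
have /(maps_rk hN) [_ h2] : maps (TN (pairs c)) (jN (key a)) n by apply/maps_TN; exists m.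
exact: (ordinal_rk hN (sup c)).1 h1 h2.
Qed.

End Atoms.

Lemma separable_Sat f : separable (fun u => Sat (pr hM u f)).
Proof.
apply: (@separable_equiv _ (fun u => exists p, is_opair p u f /\ Sat p)).
  move=> u; split=> [h|[p [/(is_opairE hM) -> //]]].
  by exists (pr hM u f); split=> //; apply: prP.
by move=> x; apply: (@separable_S1 M hM (fun M s => exists p : M, is_opair p (s 0) (s 1) /\ Sat p)
  (f .: fun=> f)); s1.
Qed.

(** With A the set of codes in S that are true of the tuple extended by m, the claim P(b) to
    which overspill is applied is that some value in N supports all codes of A of rank below b,
    in a support linked to the present one.  For b in S it holds because the code of kind
    [ExCode] over the codes of A in the level at b is itself in S and true in M. *)
Lemma forth c m : valid c -> exists c' n, [/\ valid c', pairs c' = (m, n) :: pairs c &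
  elt (rk hN (sup c')) (rk hN (sup c))].
Proof.
move=> vc; set k := key (size (pairs c)).
have [gF wF hval] := vc.
pose f := TM (pairs c); pose g := TN (pairs c); pose f' := ext hM f (jM k) m.
pose A := [set t : S | Sat (pr hM (jM t) f')].
have CA : Cod jM A by exact: (Cod_separable hM cutM (separable_Sat f')).
have CA' : Cod jN A by rewrite -eqCod.
have [a _ ha] := CA'.
have haA s : elt (jN s) a <-> A s by rewrite -ha.
have [[_ eM] iM _] := cut_initial hM cutM.
have [[_ eN] iN _] := cut_initial hN cutN.
pose R : predicate := fun M s => exists w' : M, elt w' (s 1) /\
  ((exists e : M, is_num 0 e /\ maps (s 2) e w') /\
  exists (x g' : M), is_ext (s 3) (s 4) x g' /\
  exists V, isV V (s 0) /\ forall t : M, elt t V -> ~ elt t (s 5) \/ maps w' t g').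
pose env := fam c .: sup c .: g .: jN k .: a .: fun=> g.
have [||b [ob Pb hb]] := @overspill _ _ jN hN cutN (fun b => R N (b .: env)).
- by apply: separable_S1 => //; rewrite /R; s1.
- move=> b ob rb; have [V hV] := isV_ex hN ob.
  have [v _ ev] := cut_V hN cutN ob rb hV; subst V.
  have [bv hbv] := cut_comprehension hM cutM v CA.
  have HS : Sat (pr hM (jM (codeS ExCode k k bv)) f).
    apply: Sat_Ex (codeM _ _ _ _) _ => t' ht'.
    have [s _ es] := iM _ _ ht'; subst t'.
    by have [_ As] := iffLR (hbv s) (iffRL (eM _ _) ht'); exact: As.
  have [w' [w'F [hl [x [g' [hg' h]]]]]] := valid_content vc HS.
  exists w'; split=> //; split=> //; exists x, g'; split=> //=.
  exists (jN v); split=> // t tv; have [ta|] := EM (elt t a); [right|by left].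
  have [s _ es] := iN _ _ tv; subst t.
  by apply: h; apply/eN/hbv; split; [apply/eN|apply/haA].
move: Pb => /= [w' [w'F [[e [he ew']] [n [g' [hg' [V [hV h]]]]]]]].
exists (Condition ((m, n) :: pairs c) (fam c) w'), n; split=> //=.
  split=> //= t; rewrite TM_cons TN_cons => At.
  have -> : ext hN (TN (pairs c)) (jN (key (size (pairs c)))) n = g' by apply/esym/is_extE.
  have tV : elt (jN t) V by apply/(isVE hN ob hV).
  by have [nta|//] := h _ tV; case: nta; apply/haA.
by have [] := maps_rk hN ew'.
Qed.

(** With B the set of codes in S that are not supported at the tuple extended by n, the claim
    to which overspill is applied is that some subset of m0 in M makes all codes of B of rank
    below b false.  For b in S it holds because otherwise the code of kind [SubCode] over the
    codes of B in the level at b would be true in M and hence supported in N, and n would be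
    a counterexample to it. *)
Lemma back c i m0 n0 n : valid c -> has_at (pairs c) i (m0, n0) -> subset_of n n0 ->
  exists c' m, [/\ valid c', pairs c' = (m, n) :: pairs c & sup c' = sup c].
Proof.
move=> vc hi nn0; set k := key (size (pairs c)).
have [gF wF hval] := vc.
pose f := TM (pairs c); pose g := TN (pairs c); pose g' := ext hN g (jN k) n.
pose B := [set t : S | ~ maps (sup c) (jN t) g'].
have CB' : Cod jN B.
  apply: (@Cod_separable _ _ jN hN cutN (fun t => ~ maps (sup c) t g')).
  apply: separable_not => // x.
  by apply: (@separable_S1 N hN (fun M s => maps (s 1) (s 0) (s 2))
    (sup c .: g' .: fun=> g')); s1.
have CB : Cod jM B by rewrite eqCod.
have [b _ hbB'] := CB.
have hbB s : elt (jM s) b <-> B s by rewrite -hbB'.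
have [[_ eM] iM _] := cut_initial hM cutM.
have [[_ eN] iN _] := cut_initial hN cutN.
pose R : predicate := fun M s => forall v : M, subset_of v (s 1) -> exists V, isV V (s 0) /\
  exists t : M, elt t V /\ (elt t (s 2) /\ exists f' : M, is_ext (s 3) (s 4) v f' /\
  exists p : M, is_opair p t f' /\ Sat p).
pose env := m0 .: b .: f .: jM k .: fun=> f.
have [||be [obe Pbe hbe]] := @overspill _ _ jM hM cutM (fun x => ~ R M (x .: env)).
- apply: separable_not => // x; apply: (@separable_S1 M hM R env); rewrite /R; by s1.
- move=> be obe rbe HR; have [V hV] := isV_ex hM obe.
  have [v _ ev] := cut_V hM cutM obe rbe hV; subst V.
  have [bv hbv] := cut_comprehension hM cutM v CB.
  have HS : Sat (pr hM (jM (codeS SubCode k (key i) bv)) f).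
    apply: Sat_Sub (codeM _ _ _ _) _ _; first by apply/maps_TM; exists n0; exact: hi.
    move=> u /HR /= [V [hV' [t [tV [tb [f' [/(is_extE hM) ef [p [/(is_opairE hM) ep Sp]]]]]]]]].
    have tv : elt t (jM v) by apply/(isVE hM obe hV)/(isVE hM obe hV').
    have [s _ es] := iM _ _ tv; subst t.
    exists (jM s); last by rewrite -ef -ep.
    by apply/eM/hbv; split; [apply/eM|apply/hbB].
  have [x [/(TN_at hi) -> /(_ n nn0) [t [g'' [tb [/(is_extE hN) eg tw]]]]]] := valid_content vc HS.
  have [s _ es] := iN _ _ tb; subst t.
  have [_ Bs] := iffLR (hbv s) (iffRL (eN _ _) tb).
  by apply: Bs; rewrite /g' -eg.
have [m [mm0 hm]] : exists m, subset_of m m0 /\ ~ exists V, isV V be /\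
  exists t, elt t V /\ (elt t b /\ exists f', is_ext f (jM k) m f' /\
  exists p, is_opair p t f' /\ Sat p).
  by apply: contrapT => no; apply: Pbe => v vm0; apply: contrapT => nv; apply: no; exists v.
exists (Condition ((m, n) :: pairs c) (fam c) (sup c)), m; split=> //.
split=> //= t; rewrite TM_cons TN_cons => St; apply: contrapT => nt.
apply: hm; have [V hV] := isV_ex hM obe; exists V; split=> //.
exists (jM t); split; first by apply/(isVE hM obe hV).
split; first by apply/hbB.
exists (ext hM f (jM k) m); split; first exact: extP.
by exists (pr hM (jM t) (ext hM f (jM k) m)); split=> //; apply: prP.
Qed.

Lemma valid_init l :
  (forall t : S, Sat (pr hM (jM t) (TM l)) -> Sat (pr hN (jN t) (TN l))) ->
  exists F w, valid (Condition l F w).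
Proof.
move=> h; have [v hv] := cut_superset hN cutN.
have [x hx] := @sep_S1 N hN (fun M s => exists p : M, is_opair p (s 0) (s 1) /\ Sat p)
  (TN l .: fun=> v) v ltac:(by s1).
have [||D [hD1 hD2]] := @image_ex N hN (fun M s => is_opair (s 0) (s 1) (s 2))
  (TN l .: fun=> v) x; first by s1.
  by move=> u /hx /= [_ [p [hp Sp]]]; exists p.
have [F [w [gF wF Dw]]] := collect_Sat hN hD1.
exists F, w; split=> //= t /h St.
have [|p [hp pD]] := hD2 (jN t); last by exists p => //; apply: Dw.
apply/hx; split=> //=; exists (pr hN (jN t) (TN l)); split=> //; exact: prP.
Qed.

(** The pairs of N that have a bounded support include all those needed for validity, and
    they are collected into one support with the same bound. *)
Lemma valid_bounded e l :
  (forall t : S, Sat (pr hM (jM t) (TM l)) -> SatIn e (pr hN (jN t) (TN l))) ->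
  exists F w, valid (Condition l F w) /\ subset_of w e.
Proof.
move=> h; have [v hv] := cut_superset hN cutN.
pose P : predicate := fun M s => is_opair (s 0) (s 1) (s 2) /\ SatIn (s 3) (s 0).
have [x hx] := @sep_S1 N hN (fun M s => exists p : M, is_opair p (s 0) (s 1) /\ SatIn (s 2) p)
  (TN l .: e .: fun=> v) v ltac:(by s1).
have [||Y hY] := @collection_S1 N hN P (TN l .: e .: fun=> v) x; first by rewrite /P; s1.
  by move=> u /hx /= [_ [p hp]]; exists p.
have [D hD] := @sep_S1 N hN (fun M s => SatIn (s 1) (s 0)) (e .: fun=> v) Y ltac:(by s1).
have [p /hD []//|F [w [gF wF Dw we]]] := @collect_SatIn N hN e D.
exists F, w; split=> //; split=> //= t /h St.
have [|p pY [hp Sp]] := hY (jN t); last by exists p => //; apply/Dw/hD.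
apply/hx; split=> //=; exists (pr hN (jN t) (TN l)); split=> //; exact: prP.
Qed.

(** The rank of the support must not grow, so that it bounds the ranks of all later values. *)
Definition refines c' c :=
  (forall i x, has_at (pairs c) i x -> has_at (pairs c') i x) /\
  (elt (rk hN (sup c')) (rk hN (sup c)) \/ rk hN (sup c') = rk hN (sup c)).

Lemma refines_refl c : refines c c.
Proof. by split=> //; right. Qed.

Lemma refines_trans c1 c2 c3 : refines c1 c2 -> refines c2 c3 -> refines c1 c3.
Proof.
move=> [h1 r12] [h2 r23]; split; first by move=> i x /h2 /h1.
case: r12 => [r12|->//]; left; case: r23 => [r23|<-//].
exact: (ordinal_rk hN (sup c3)).1 r23 r12.
Qed.

Lemma refines_cons c c' x : pairs c' = x :: pairs c ->
  elt (rk hN (sup c')) (rk hN (sup c)) \/ rk hN (sup c') = rk hN (sup c) -> refines c' c.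
Proof. by move=> e h; split=> // i y hy; rewrite e; right. Qed.

(** The subsets of the level at b are exactly the sets of rank at most b. *)
Definition obstructed c b := exists t : S, Sat (pr hM (jM t) (TM (pairs c))) /\
  forall V, isV V b -> ~ SatIn V (pr hN (jN t) (TN (pairs c))).

(** Without an obstruction there is a support for the same pairs of rank at most b, and a
    step forth from it, or from the present support if that has smaller rank, ends below b. *)
Lemma descend c b : valid c -> ordinal b ->
  (exists c', [/\ valid c', refines c' c & elt (rk hN (sup c')) b]) \/ obstructed c b.
Proof.
move=> vc ob; have [|nob] := EM (obstructed c b); [by right|left].
have [V hV] := isV_ex hN ob.
have [t St|F [w [vw wV]]] := @valid_bounded V (pairs c).
  apply: contrapT => nS; apply: nob; exists t; split=> // V' hV' SV'; apply: nS.
  have <- // : V' = V.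
  by apply: (elt_ext hN) => z; rewrite (isVE hN ob hV) (isVE hN ob hV').
have wb : subset_of (rk hN w) b.
  by move=> z /(elt_rkE hN) [y /wV /(isVE hN ob hV) yb] [zy|->//]; apply: ob.1 yb zy.
have [rw|rw|rc] := ordinal_trichotomy hN (ordinal_rk hN w) (ordinal_rk hN (sup c)).
- have [c' [n [vc' ec' rc']]] := forth (jM (key 0)) vw.
  exists c'; split=> //; last exact: wb.
  apply: (@refines_cons c c' _ ec'); left; exact: (ordinal_rk hN (sup c)).1 rw rc'.
- have [c' [n [vc' ec' rc']]] := forth (jM (key 0)) vw.
  exists c'; split=> //; last exact: wb.
  by apply: (@refines_cons c c' _ ec'); left; rewrite -rw.
- have [c' [n [vc' ec' rc']]] := forth (jM (key 0)) vc.
  exists c'; split=> //; first by apply: (@refines_cons c c' _ ec'); left.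
  by apply: wb; apply: (ordinal_rk hN w).1 rc rc'.
Qed.

Section Limit.
Variables (i : M -> N) (hi : initial i).
Hypothesis fix_i : forall s, i (jM s) = jN s.

Lemma initial_tup l : (forall a m n, has_at l a (m, n) -> i m = n) -> i (TM l) = TN l.
Proof.
elim: l => [|[m n] l IH] h; first exact: fix_i.
rewrite TM_cons TN_cons -IH; last by move=> a m' n' h'; apply: (h a); right.
rewrite -(h (size l) m n) /=; last by left.
rewrite -fix_i; apply/(is_extE hN).
exact: (@initial_S1 _ _ _ hi _ (TM l .: jM (key (size l)) .: m .:
  ext hM (TM l) (jM (key (size l))) m .: fun=> m) hM hN (S1_is_ext 0 1 2 3) (extP _ _ _ _)).
Qed.

(** A support in M for the obstructing truth is mapped by i to a support in N, which must
    have rank above b. *)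
Lemma obstructed_range c b : ordinal b ->
  (forall a m n, has_at (pairs c) a (m, n) -> i m = n) -> obstructed c b -> range i b.
Proof.
move=> ob hc [t [[F [w [gF [wF pw]]]] no]].
have [V hV] := isV_ex hN ob.
have pE : i (pr hM (jM t) (TM (pairs c))) = pr hN (jN t) (TN (pairs c)).
  apply/(is_opairE hN); rewrite -fix_i -initial_tup //; apply/(initial_is_opair hi).
  exact: prP.
have gF' : good (i F).
  exact: (@initial_S1 _ _ _ hi _ (fun=> F) hM hN (S1_good 0) gF).
have [[_ ei] _ _] := hi.
have [z zw nzV] : exists2 z, elt z (i w) & ~ elt z V.
  apply: contrapT => nz; apply: (no V hV); exists (i F), (i w); split=> //.
  split; first exact/ei; split; first by rewrite -pE; apply/ei.
  by move=> z zw; apply: contrapT => nzV; apply: nz; exists z.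
have [_ ri] := initial_rank_initial_embedding hM hN hi.
apply: (ri w); apply/(rank_leE hN); left; rewrite (rk_ordinal hN ob).
have zb : ~ elt (rk hN z) b by move=> h; apply/nzV/(isVE hN ob hV).
have [//|<-|bz] := ordinal_trichotomy hN (ordinal_rk hN z) ob; first exact: rk_elt.
exact: (ordinal_rk hN (i w)).1 (rk_elt hN zw) bz.
Qed.

End Limit.

End BackAndForth.

(** * The limit of a generic sequence of conditions *)

(** If n is a member of i m, then {n} is a value i x.  This x has a member, since otherwise it
    would be the set that is mapped to the empty set; and its member is mapped to n. *)
Lemma subset_closed_initial (M N : structure) (i : M -> N) :
  models M KPPS -> models N KPPS -> embedding i ->
  (forall m n, subset_of n (i m) -> range i n) -> initial i.
Proof.
move=> hM hN ei si; split=> // m n nm.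
have [p hp] := ax_upair hN n n.
have [|x _ ex] := si m p; first by move=> z /hp [->|->].
have [z zx] : exists z, elt z x.
  apply: contrapT => nx; have [e he] := empty_ex hN n.
  have [|y _ ey] := si m e; first by move=> z /he.
  have exy : x = y.
    apply: (elt_ext hM) => z; split=> [zx|/ei.2]; first by case: nx; exists z.
    by rewrite ey => /he.
  by apply: (he n); rewrite -ey -exy ex; apply/hp; left.
exists z => //; move: zx => /ei.2; rewrite ex => /hp; by case.
Qed.

Section Generic.
Variables (M N S : structure) (jM : S -> M) (jN : S -> N).
Variables (hM : models M KPPS) (hN : models N KPPS).
Variables (cutM : rank_cut jM) (cutN : rank_cut jN).
Hypothesis eqCod : Cod jM = Cod jN.
Variables (eM : M -> nat) (eN : N -> nat).
Hypotheses (eM_inj : injective eM) (eN_inj : injective eN).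

Local Notation valid := (@valid M N S jM jN hM hN cutM).
Local Notation refines := (refines hN).
Local Notation obstructed := (@obstructed M N S jM jN hM hN cutM).

(** The requirements at step k: to decide the value at the k-th element of M, whether the k-th
    element of N is a value, and the position of the k-th element of N, if an ordinal, with
    respect to the range.  A negative answer for a value must hold for all later conditions. *)
Definition meets k (c : condition M N) := [/\
  forall m, eM m = k -> exists n a, has_at (pairs c) a (m, n),
  forall n, eN n = k -> (exists m a, has_at (pairs c) a (m, n)) \/
    forall c', valid c' -> refines c' c ->
    forall a m0 n0, has_at (pairs c') a (m0, n0) -> ~ subset_of n n0 &
  forall b, eN b = k -> ordinal b -> elt (rk hN (sup c)) b \/ obstructed c b].

(** The requirement on ordinals comes last, since an obstruction for a condition concerns its
    own list of pairs. *)
Lemma meets_dense k c : valid c -> exists c', [/\ valid c', refines c' c & meets k c'].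
Proof.
move=> vc.
have [c1 [vc1 r1 h1]] : exists c1, [/\ valid c1, refines c1 c &
    forall m, eM m = k -> exists n a, has_at (pairs c1) a (m, n)].
  have [[m em]|no] := EM (exists m, eM m = k); last first.
    exists c; split=> //; first exact: refines_refl.
    by move=> m em; case: no; exists m.
  have [c1 [n [vc1 ec1 rc1]]] := forth cutN eqCod m vc.
  exists c1; split=> //; first by apply: (refines_cons ec1); left.
  move=> m'; rewrite -em => /eM_inj ->; exists n, (size (pairs c)).
  by rewrite ec1; left.
have [c2 [vc2 r2 h2]] : exists c2, [/\ valid c2, refines c2 c1 &
    forall n, eN n = k -> (exists m a, has_at (pairs c2) a (m, n)) \/
    forall c', valid c' -> refines c' c2 ->
    forall a m0 n0, has_at (pairs c') a (m0, n0) -> ~ subset_of n n0].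
  have [[n [en [c' [vc' [r' [a [m0 [n0 [ha nn0]]]]]]]]]|no] := EM (exists n, eN n = k /\
    exists c', valid c' /\ (refines c' c1 /\ exists a m0 n0,
      has_at (pairs c') a (m0, n0) /\ subset_of n n0)); last first.
    exists c1; split=> //; first exact: refines_refl.
    move=> n en; right=> c' vc' r' a m0 n0 ha nn0; apply: no; exists n; split=> //.
    by exists c'; split=> //; split=> //; exists a, m0, n0.
  have [c2 [m [vc2 ec2 rc2]]] := back cutN eqCod vc' ha nn0.
  exists c2; split=> //.
    by apply: refines_trans r'; apply: (refines_cons ec2); right; rewrite rc2.
  move=> n'; rewrite -en => /eN_inj ->; left; exists m, (size (pairs c')).
  by rewrite ec2; left.
have [c3 [vc3 r3 h3]] : exists c3, [/\ valid c3, refines c3 c2 &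
    forall b, eN b = k -> ordinal b -> elt (rk hN (sup c3)) b \/ obstructed c3 b].
  have [[b [eb ob]]|no] := EM (exists b, eN b = k /\ ordinal b); last first.
    exists c2; split=> //; first exact: refines_refl.
    by move=> b eb ob; case: no; exists b.
  have [[c3 [vc3 r3 hb]]|hob] := descend cutN eqCod vc2 ob.
    by exists c3; split=> // b'; rewrite -eb => /eN_inj -> _; left.
  exists c2; split=> //; first exact: refines_refl.
  by move=> b'; rewrite -eb => /eN_inj -> _; right.
exists c3; split=> //; first by apply: refines_trans (refines_trans r3 r2) r1.
split=> //.
  by move=> m /h1 [n [a ha]]; exists n, a; apply/r3.1/r2.1.
move=> n /h2 [[m [a ha]]|h]; first by left; exists m, a; apply/r3.1.
by right=> c' vc' r'; apply: h => //; apply: refines_trans r3.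
Qed.

Variable c0 : condition M N.
Hypothesis vc0 : valid c0.

Lemma generic_chain : exists c : nat -> condition M N, [/\ c 0 = c0,
  forall k, valid (c k), forall k l, k <= l -> refines (c l) (c k) &
  forall k, meets k (c k.+1)].
Proof.
have next k (c : {c | valid c}) : {c' : {c | valid c} |
    refines (sval c') (sval c) /\ meets k (sval c')}.
  apply: cid; have [c' [vc' r' m']] := meets_dense k (svalP c).
  by exists (exist _ c' vc').
pose f := fix f k := if k is k'.+1 then sval (next k' (f k')) else exist _ c0 vc0.
exists (fun k => sval (f k)); split=> //.
- by move=> k; exact: svalP.
- move=> k l /subnK <-; elim: (l - k) => [|n IH]; first exact: refines_refl.
  by rewrite addSn; apply: refines_trans IH; have [] := svalP (next (n + k) (f (n + k))).
- by move=> k; have [] := svalP (next k (f k)).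
Qed.

Lemma generic_embedding : exists i : M -> N, rank_cut i /\ fixes_pointwise jM jN i.
Proof.
have [c [_ vc rc mc]] := generic_chain.
pose Rel m n := exists k a, has_at (pairs (c k)) a (m, n).
have common m n m' n' : Rel m n -> Rel m' n' -> exists k a b,
    has_at (pairs (c k)) a (m, n) /\ has_at (pairs (c k)) b (m', n').
  move=> [k [a ha]] [l [b hb]]; exists (maxn k l), a, b.
  by split; [apply: (rc k _ _).1 ha; apply: leq_maxl|apply: (rc l _ _).1 hb; apply: leq_maxr].
have total m : exists n, Rel m n.
  by have [h _ _] := mc (eM m); have [n [a ha]] := h m erefl; exists n, (eM m).+1, a.
pose i m := projT1 (cid (total m)).
have Ri m : Rel m (i m) by rewrite /i; case: cid.
have iE m n : Rel m n -> i m = n.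
  move=> hR; have [k [a [b [ha hb]]]] := common _ _ _ _ (Ri m) hR.
  exact: (valid_eq cutN (vc k) ha hb erefl).
have mem x y : elt x y <-> elt (i x) (i y).
  have [k [a [b [ha hb]]]] := common _ _ _ _ (Ri x) (Ri y).
  split; first exact: (valid_mem cutN (vc k) ha hb).
  by move=> h; apply: contrapT => /(valid_nmem cutN (vc k) ha hb).
have ei : embedding i.
  by split=> // x y exy; apply: (elt_ext hM) => z; rewrite !mem exy.
have hi : initial i.
  apply: subset_closed_initial => // m n nm.
  have [_ h _] := mc (eN n); case: (h n erefl) => [[m' [a ha]]|{}h].
    by exists m' => //; apply: iE; exists (eN n).+1, a.
  have [k [a ha]] := Ri m.
  case: (h (c (maxn k (eN n).+1)) (vc _) _ a m (i m)) => //.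
    by apply: rc; apply: leq_maxr.
  by apply: (rc k _ _).1 ha; apply: leq_maxl.
have fix_i s : i (jM s) = jN s.
  have [k [a ha]] := Ri (jM s); exact: (valid_const cutN (vc k) ha erefl).
have hat k a m n : has_at (pairs (c k)) a (m, n) -> i m = n.
  by move=> ha; apply: iE; exists k, a.
have irk m k : elt (rk hN (i m)) (rk hN (sup (c k))).
  have [l [a ha]] := Ri m.
  have ha' : has_at (pairs (c (maxn k l))) a (m, i m).
    by apply: (rc l _ _).1 ha; apply: leq_maxr.
  have h := valid_rk cutN (vc _) ha'.
  have [_ [h'|<-//]] := rc k (maxn k l) (leq_maxl k l).
  exact: (ordinal_rk hN (sup (c k))).1 h' h.
exists i; split; last exact: fix_i.
split; first exact: initial_rank_initial_embedding.
split.
  exists (rk hN (sup (c 0))); first exact: ordinal_rk.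
  by move=> _ [m _ <-]; apply/(rank_belowE hN).
move=> b ob nb; have [_ _ h] := mc (eN b).
case: (h b erefl ob) => [{}h|hob]; last first.
  case: nb; exact: (obstructed_range hi fix_i ob (hat _) hob).
exists (rk hN (sup (c (eN b).+1))); split=> //; first exact: ordinal_rk.
move=> [m _ em]; have := irk m (eN b).+1; rewrite em rk_ordinal; last exact: ordinal_rk.
exact: elt_irrefl.
Qed.

End Generic.

(** * The equivalences *)

(** The two records have the same base structure, so the equality of their second components
    follows by proof irrelevance. *)
Lemma SSy_eqP (S M N : structure) (jM : S -> M) (jN : S -> N) :
  SSy jM = SSy jN <-> Cod jM = Cod jN.
Proof.
split=> [e|]; last by rewrite /SSy => ->.
suff H X : SSy jM = X -> forall h : so_base X = S,
    eq_rect _ (fun B : structure => set (set B)) (@so_sets X) _ h = Cod jM.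
  by rewrite -(H _ e erefl).
by move=> <- /= h; rewrite (Prop_irrelevance h erefl).
Qed.

Section Necessity.
Variables (M N S : structure) (jM : S -> M) (jN : S -> N).
Variables (hM : models M KPPS) (hN : models N KPPS).
Variables (cutM : rank_cut jM) (i : M -> N) (hi : initial i).
Hypothesis fix_i : forall s, i (jM s) = jN s.

(** A subset of S cut out by an element of N is cut out by its intersection with the image of a
    set of M that includes S; this intersection is in the range of i. *)
Lemma initial_Cod : Cod jM = Cod jN.
Proof.
have [[_ ei] _ si] := hi.
apply/seteqP; split=> _ [c _ <-].
  by exists (i c) => //; apply/seteqP; split=> s /=; rewrite -fix_i -ei.
have [v hv] := cut_superset hM cutM.
have [d hd] := @sep_S1 N hN (fun M s => elt (s 0) (s 1)) (i v .: fun=> c) c ltac:(by s1).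
have [|b _ eb] := si v d; first by move=> z /hd [].
exists b => //; apply/seteqP; split=> s /=.
  by move=> /ei; rewrite eb fix_i => /hd [].
by move=> sc; apply/ei; rewrite eb; apply/hd; rewrite fix_i; split=> //=; rewrite -fix_i; apply/ei.
Qed.

(** Formulae that are provably equivalent to Sigma_1^P ones are covered by soundness. *)
Lemma initial_Th : Th (SigmaP 1) jM `<=` Th (SigmaP 1) jN.
Proof.
move=> [p s] [/= hp hs]; split=> //=.
have [_ [q hq <-] pq] := hp.
have [h1 h2] := soundness (KPP_KPPS hM) pq (s := jM \o s) (fun _ => False_ind _).
have [h3 h4] := soundness (KPP_KPPS hN) pq (s := jN \o s) (fun _ => False_ind _).
have [x hx] := h1 hs; apply: h4; exists (i x).
have /(initial_Delta0P hi hq) := hx.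
apply: iffLR; apply: sat_ext => -[//|k] /=; exact: fix_i.
Qed.

End Necessity.

Section Sufficiency.
Variables (M N S : structure) (jM : S -> M) (jN : S -> N).
Variables (hM : models M KPPS) (hN : models N KPPS).
Variables (cutM : rank_cut jM) (cutN : rank_cut jN).

(** Truth is defined by one Sigma_1^P-formula, the same in M and in N. *)
Lemma Th_Sat (a t : S) : Th (SigmaP 1) jM `<=` Th (SigmaP 1) jN ->
  Sat (pr hM (jM t) (jM a)) -> Sat (pr hN (jN t) (jN a)).
Proof.
have [p hp h] : S1 (fun M s => exists q : M, is_opair q (s 0) (s 1) /\ Sat q) by s1.
move=> hTh St; have [] := hTh (fEx p, t .: a .: fun=> a).
  split; first by exists (fEx p); [exists p|apply: provable_iff_refl].
  by apply/(h M hM) => /=; exists (pr hM (jM t) (jM a)); split=> //; apply: prP.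
by move=> _ /= /(h N hN) /= [q [/(is_opairE hN) -> ]].
Qed.

Lemma rank_cut_ex : countable [set: M] -> countable [set: N] -> Cod jM = Cod jN ->
  Th (SigmaP 1) jM `<=` Th (SigmaP 1) jN ->
  exists i : M -> N, rank_cut i /\ fixes_pointwise jM jN i.
Proof.
move=> /countable_injP [eM eM_inj] /countable_injP [eN eN_inj] eqCod hTh.
have [t|F [w vw]] := @valid_init _ _ _ _ _ hM hN cutM cutN [::]; first exact: Th_Sat.
by apply: (generic_embedding cutN eqCod _ _ vw) => x y; [apply: eM_inj|apply: eN_inj];
  rewrite inE.
Qed.
End Sufficiency.

Theorem corollary7p7 (M N S : structure) (jM : S -> M) (jN : S -> N)
    (hM : models M (KPP `|` Separation (SigmaP 1)))
    (hN : models N (KPP `|` Separation (SigmaP 1)))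
    (cM : countable [set: M]) (cN : countable [set: N])
    (nsM : nonstandard M) (nsN : nonstandard N)
    (hS : common_rank_cut jM jN) :
  [<-> (* (a) *)
       exists i : M -> N, rank_initial_embedding i /\ fixes_pointwise jM jN i;
       (* (a') *)
       exists i : M -> N, rank_cut i /\ fixes_pointwise jM jN i;
       (* (b) *)
       SSy jM = SSy jN /\ Th (SigmaP 1) jM `<=` Th (SigmaP 1) jN].
Proof.
have [cutM cutN] := hS.
have necessity : (exists i : M -> N, rank_initial_embedding i /\ fixes_pointwise jM jN i) ->
    SSy jM = SSy jN /\ Th (SigmaP 1) jM `<=` Th (SigmaP 1) jN.
  move=> [i [ri fix_i]]; have hi := rank_initial_embedding_initial hN ri.
  split; first exact/SSy_eqP/(initial_Cod hM hN cutM hi fix_i).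
  exact: (initial_Th hM hN hi fix_i).
tfae.
- by move=> /necessity [/SSy_eqP eqCod hTh]; apply: rank_cut_ex.
- by move=> [i [[ri _] fix_i]]; apply: necessity; exists i.
- move=> [/SSy_eqP eqCod hTh].
  by have [i [[ri _] fix_i]] := rank_cut_ex hM hN cutM cutN cM cN eqCod hTh; exists i.
Qed.
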